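(* Let $G$ be a compactly generated, totally disconnected, locally compact group. The following conditions are equivalent. (1) $\mathrm{md}(G)=2$. (2) $G$ has precisely two ends. (3) There is a continuous surjective homomorphism, whose kernel is a compact open subgroup of $G$, from $G$ onto the infinite cyclic group $\mathbb{Z}$ or onto the infinite dihedral group $D_\infty$ (both with the discrete topology). (4) $G$ has a discrete infinite cyclic subgroup $C$ such that $G/C$ is compact.
   Context: Graphs are simple and undirected. Let $G$ be a totally disconnected, locally compact group. A Cayley–Abels graph for $G$ is a connected, locally finite graph $\Gamma$ with an action of $G$ on $\Gamma$ by graph automorphisms (not necessarily faithful) that is transitive on vertices and such that every vertex stabilizer $G_\alpha$ is a compact open subgroup of $G$. Such a graph exists if and only if $G$ is compactly generated. $\mathrm{md}(G)$ denotes the minimal degree of a Cayley–Abels graph for $G$. A ray in a graph is a one-way infinite sequence of pairwise distinct vertices $(\alpha_0,\alpha_1,\dots)$ with consecutive vertices adjacent; two rays are equivalent if there is a third ray meeting each of them in infinitely many vertices; an end is an equivalence class of rays. Any two Cayley–Abels graphs of $G$ have the same number of ends, and the number of ends of $G$ is defined as the number of ends of any Cayley–Abels graph of $G$. *)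

(* Defs.v *)
From HB Require Import structures.
From Stdlib Require Import Relations.
From mathcomp Require Import all_boot all_order all_algebra.
From mathcomp Require Import all_classical topology.
Set Implicit Arguments. Unset Strict Implicit. Unset Printing Implicit Defensive.
Import Order.TTheory GRing.Theory Num.Theory.
Local Open Scope classical_set_scope.

Record tgroup (G : topologicalType) := TGroup {
  gmul : G -> G -> G;
  ginv : G -> G;
  gone : G;
  gmulA : forall x y z, gmul x (gmul y z) = gmul (gmul x y) z;
  gmul1 : forall x, gmul gone x = x /\ gmul x gone = x;
  gmulV : forall x, gmul (ginv x) x = gone /\ gmul x (ginv x) = gone;
  gmul_cont : continuous (fun p : G * G => gmul p.1 p.2);
  ginv_cont : continuous ginv }.

Section Defs.
Context {G : topologicalType} (g : tgroup G).
Local Notation "x * y" := (gmul g x y).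
Local Notation "1" := (gone g).

Definition is_subgroup (H : set G) : Prop :=
  H 1 /\ (forall x y, H x -> H y -> H (x * y)) /\ (forall x, H x -> H (ginv g x)).

Definition tdlc : Prop :=
  totally_disconnected [set: G] /\
  (forall x : G, exists K : set G, nbhs x K /\ compact K).

Definition generates (K : set G) : Prop :=
  forall H : set G, is_subgroup H -> K `<=` H -> H = setT.

Definition compactly_generated : Prop :=
  exists K : set G, compact K /\ generates K.

Definition cayley_abels (V : Type) (adj : V -> V -> Prop) (act : G -> V -> V)
  : Prop :=
  inhabited V /\
  ((forall v w, adj v w -> adj w v) /\ (forall v, ~ adj v v)) /\
  (forall v w, clos_refl_trans V adj v w) /\
  (forall v, finite_set [set w | adj v w]) /\
  ((forall v, act 1 v = v) /\
   (forall x y v, act (x * y) v = act x (act y v)) /\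
   (forall x v w, adj v w <-> adj (act x v) (act x w))) /\
  (forall v w, exists x, act x v = w) /\
  (forall v, open [set x | act x v = v] /\ compact [set x | act x v = v]).

Definition graph_degree (V : Type) (adj : V -> V -> Prop) (d : nat) : Prop :=
  forall v, ([set w | adj v w] #= `I_d)%card.

Definition md_eq (d : nat) : Prop :=
  (exists (V : Type) (adj : V -> V -> Prop) (act : G -> V -> V),
      cayley_abels adj act /\ graph_degree adj d) /\
  (forall (V : Type) (adj : V -> V -> Prop) (act : G -> V -> V) (e : nat),
      cayley_abels adj act -> graph_degree adj e -> (d <= e)%N).

Definition is_ray (V : Type) (adj : V -> V -> Prop) (r : nat -> V) : Prop :=
  injective r /\ forall n, adj (r n) (r n.+1).

Definition ray_equiv (V : Type) (adj : V -> V -> Prop) (r1 r2 : nat -> V) : Prop :=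
  exists r3, is_ray adj r3 /\
    infinite_set (range r3 `&` range r1) /\ infinite_set (range r3 `&` range r2).

Definition two_ended_graph (V : Type) (adj : V -> V -> Prop) : Prop :=
  exists r1 r2, [/\ is_ray adj r1, is_ray adj r2, ~ ray_equiv adj r1 r2 &
    forall r, is_ray adj r -> ray_equiv adj r r1 \/ ray_equiv adj r r2].

(* G has precisely two ends: (some, equivalently every) Cayley--Abels graph
   of G has precisely two ends *)
Definition two_ended : Prop :=
  exists (V : Type) (adj : V -> V -> Prop) (act : G -> V -> V),
    cayley_abels adj act /\ two_ended_graph adj.

End Defs.

(* The infinite dihedral group D_oo = Z x| Z/2, elements (a, s) with s : bool,
   (a, s) (b, t) = (a + (-1)^s b, s xor t). *)
Definition Dinf := (int * bool)%type.
Definition dmul (x y : Dinf) : Dinf :=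
  ((x.1 + (if x.2 then - y.1 else y.1))%R, x.2 (+) y.2).
Definition done : Dinf := (0%R, false).

Section Defs2.
Context {G : topologicalType} (g : tgroup G).
Local Notation "x * y" := (gmul g x y).
Local Notation "1" := (gone g).

Definition onto_Z_compact_open_kernel : Prop :=
  exists phi : G -> int,
    [/\ (forall x y, phi (x * y) = (phi x + phi y)%R),
        (forall n, open (phi @^-1` [set n])),
        (forall n, exists x, phi x = n),
        open [set x | phi x = 0%R] & compact [set x | phi x = 0%R]].

Definition onto_Dinf_compact_open_kernel : Prop :=
  exists phi : G -> Dinf,
    [/\ (forall x y, phi (x * y) = dmul (phi x) (phi y)),
        (forall n, open (phi @^-1` [set n])),
        (forall n, exists x, phi x = n),
        open [set x | phi x = done] & compact [set x | phi x = done]].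

Definition gpow (c : G) (n : int) : G :=
  match n with
  | Posz k => iter k (gmul g c) 1
  | Negz k => ginv g (iter k.+1 (gmul g c) 1)
  end.

Definition cyclic_sub (c : G) : set G := [set x | exists n : int, x = gpow c n].

Definition discrete_sub (C : set G) : Prop :=
  forall x, C x -> exists U : set G, open U /\ U `&` C = [set x].

(* the coset space G/C = {xC} with the quotient topology is compact:
   open sets of G/C are exactly the images of open sets U of G with U C = U *)
Definition compact_quotient (C : set G) : Prop :=
  forall (I : Type) (U : I -> set G),
    (forall i, open (U i) /\ (forall x y, U i x -> C y -> U i (x * y))) ->
    setT = \bigcup_i U i ->
    exists F : set I, finite_set F /\ setT = \bigcup_(i in F) U i.

Definition has_cocompact_discrete_Z : Prop :=
  exists c : G, let C := cyclic_sub c in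
    [/\ infinite_set C, discrete_sub C & compact_quotient C].

End Defs2.

(* Main.v *)
Require Import Defs.
From Stdlib Require Import Relations.
From mathcomp Require Import all_boot all_order all_algebra.
From mathcomp Require Import finmap zify ring.
From mathcomp Require Import all_classical topology.
Set Implicit Arguments. Unset Strict Implicit. Unset Printing Implicit Defensive.
Import Order.TTheory GRing.Theory Num.Theory.
Local Open Scope classical_set_scope.

(* Let [G] act on a Cayley-Abels graph and let [A] be a set of vertices with
   finite boundary, infinite and co-infinite, all of whose translates are, up to
   finitely many vertices, [A] or its complement.  Counting vertices in
   differences gives an action of [G] on [Z] by translations and reflections,
   that is, a homomorphism to [Dinf].  Its kernel contains the pointwise
   stabilizer of the boundary of [A], hence is open.  If [F] is a finite
   connected set containing the boundary and [x F] is disjoint from [F], then [A]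
   and [x A] are nested and distinct, so [x] is not in the kernel; hence the
   kernel is compact.  An infinite subgroup of [Dinf] is isomorphic to [Z] or to
   [Dinf], which gives condition (3).

   Such a set [A] exists in each of the other cases: half of the line if the
   graph is infinite and 2-regular; a component of the complement of a finite
   set separating two inequivalent rays if the graph has two ends; and the
   forward half-orbits of a cocompact discrete cyclic group acting on the coset
   graph of a compact open subgroup, which van Dantzig's theorem provides.
   Conversely, (3) makes [G] act on the line, and this action yields (1), (2)
   and (4). *)

(** * Sets up to finite difference, and boundaries in graphs *)

Section FiniteDifference.
Context {V : choiceType}.
Implicit Types A B C F : set V.

Definition almost_eq A B := finite_set (A `\` B) /\ finite_set (B `\` A).

Lemma almost_eq_refl A : almost_eq A A.
Proof. by rewrite /almost_eq setDv. Qed.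

Lemma almost_eq_sym A B : almost_eq A B -> almost_eq B A.
Proof. by case. Qed.

Lemma almost_eq_trans B A C : almost_eq A B -> almost_eq B C -> almost_eq A C.
Proof.
have tr (X Y Z : set V) : finite_set (X `\` Y) -> finite_set (Y `\` Z) ->
    finite_set (X `\` Z).
  move=> fXY fYZ; apply: (@sub_finite_set _ _ ((X `\` Y) `|` (Y `\` Z))).
    by move=> v [Xv nZv]; have [Yv|nYv] := pselect (Y v); [right|left].
  by rewrite finite_setU.
by case=> AB BA [BC CB]; split; apply: (tr _ B).
Qed.

Lemma almost_eqC A B : almost_eq A B -> almost_eq (~` A) (~` B).
Proof. by case=> AB BA; split; rewrite setDE setCK setIC -setDE. Qed.

(** The sign plays the role of the second component of [Dinf]: complementation stands for the
    exchange of the two ends. *)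
Definition setCb (s : bool) A := if s then ~` A else A.

Lemma setCbD s t A : setCb s (setCb t A) = setCb (s (+) t) A.
Proof. by case: s; case: t; rewrite //= setCK. Qed.

Lemma almost_eq_setCb s A B : almost_eq A B -> almost_eq (setCb s A) (setCb s B).
Proof. by case: s => //; exact: almost_eqC. Qed.

Lemma almost_eq_infinite A B : almost_eq A B -> infinite_set A ->
  infinite_set (A `&` B).
Proof.
move=> [fAB _] iA fI; apply: iA.
by rewrite -(setDUK (@subIsetl _ A B)) setDIr setDv set0U finite_setU.
Qed.

(** The net number of vertices gained in passing from [A] to [B]. As [fset_set] is empty on infinite
    sets, the value is meaningful only for almost equal sets. *)
Definition idx A B : int :=
  (#|` fset_set (B `\` A)|%:Z - #|` fset_set (A `\` B)|%:Z)%R.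

(** The common part of [A] and [B] inside [F] cancels. With one window [F] for several sets, indices
    become differences of counts and telescope. *)
Lemma idxE F A B : finite_set F -> A `\` B `<=` F -> B `\` A `<=` F ->
  (idx A B = #|` fset_set (B `&` F)|%:Z - #|` fset_set (A `&` F)|%:Z)%R.
Proof.
move=> fF AB BA.
have split (X Y : set V) : X `\` Y `<=` F -> (#|` fset_set (X `&` F)| =
    #|` fset_set (X `&` Y `&` F)| + #|` fset_set (X `\` Y)|)%N.
  move=> XY.
  have -> : X `&` F = (X `&` Y `&` F) `|` (X `\` Y).
    apply/seteqP; split=> v /=.
      by move=> [Xv Fv]; have [Yv|nYv] := pselect (Y v); [left|right].
    by case=> [[[? _] ?]|[? ?]]; split=> //; apply: XY.
  have f1 : finite_set (X `&` Y `&` F) by exact: finite_setIr.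
  have f2 : finite_set (X `\` Y) by exact: sub_finite_set XY fF.
  rewrite fset_setU // cardfsU -fset_setI //.
  suff -> : X `&` Y `&` F `&` (X `\` Y) = set0.
    by rewrite fset_set0 cardfs0 subn0.
  by apply/seteqP; split=> v //= [[[_ ?] _] [_]].
rewrite (split _ _ AB) (split _ _ BA) (setIC B A) /idx; lia.
Qed.

Lemma idx_trans A B C : almost_eq A B -> almost_eq B C ->
  (idx A C = idx A B + idx B C)%R.
Proof.
move=> eAB eBC; have [fAC fCA] := almost_eq_trans eAB eBC.
case: eAB eBC => [fAB fBA] [fBC fCB].
pose F := (A `\` B) `|` (B `\` A) `|` (B `\` C) `|` (C `\` B) `|` (A `\` C) `|`
  (C `\` A).
have fF : finite_set F by rewrite /F !finite_setU.
rewrite !(@idxE F) //; first by lia.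
all: by move=> v [Hv nHv]; rewrite /F /=; tauto.
Qed.

Lemma idxC A B : (idx (~` A) (~` B) = - idx A B)%R.
Proof.
by rewrite /idx !setDE !setCK ![~` _ `&` _]setIC opprB.
Qed.

Lemma idx_setCb s A B : (idx (setCb s A) (setCb s B) =
  if s then - idx A B else idx A B)%R.
Proof. by case: s; rewrite //= idxC. Qed.

Lemma idx_preimage (f h : V -> V) A B : cancel f h -> cancel h f ->
  almost_eq A B -> idx (f @^-1` A) (f @^-1` B) = idx A B.
Proof.
move=> fK hK [AB BA]; rewrite /idx.
have E (X : set V) : f @^-1` X = h @` X.
  apply/seteqP; split=> [v /= Xv|_ [v Xv <-]] /=; last by rewrite hK.
  by exists (f v).
have c (X : set V) : finite_set X -> #|` fset_set (f @^-1` X)| = #|` fset_set X|.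
  move=> fX; rewrite E fset_set_image // card_imfset //; exact: can_inj hK.
by rewrite (c _ AB) (c _ BA).
Qed.

Lemma almost_eq_preimage (f h : V -> V) A B : cancel f h -> cancel h f ->
  almost_eq A B -> almost_eq (f @^-1` A) (f @^-1` B).
Proof.
move=> fK hK [AB BA].
have E (X : set V) : finite_set X -> finite_set (f @^-1` X).
  by move=> /(finite_image h); apply: sub_finite_set => v Xv; exists (f v).
by split; [exact: E AB|exact: E BA].
Qed.

(** For nested sets nothing cancels: the index is the cardinality of the difference. *)
Lemma idx0_subset A B : almost_eq A B -> A `<=` B -> idx A B = 0%R -> A = B.
Proof.
move=> [AB BA] sAB; rewrite /idx.
have -> : A `\` B = set0 by rewrite setD_eq0.
rewrite fset_set0 cardfs0 subr0 => /eqP; rewrite eqz_nat cardfs_eq0 => /eqP.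
by move=> /(fset_set_set0 BA); rewrite setD_eq0 => sBA; apply/seteqP.
Qed.

Lemma idx_antisym A B : (idx B A = - idx A B)%R.
Proof. by rewrite /idx opprB. Qed.

End FiniteDifference.

Section Boundary.
Context {V : choiceType} (adj : V -> V -> Prop).
Hypothesis adjC : forall v w, adj v w -> adj w v.
Implicit Types A B F P : set V.

(** Both endpoints of a crossing edge are taken, so that a set and its complement have the same
    boundary. *)
Definition bd A : set V := [set v | exists2 w, adj v w & ~ (A v <-> A w)].

Lemma bd_out A v w : adj v w -> ~ bd A v -> (A v <-> A w).
Proof. by move=> vw nb; apply: contrapT => n; apply: nb; exists w. Qed.

Lemma bdC A : bd (~` A) = bd A.
Proof.
by apply/seteqP; split=> v [w vw H]; exists w => // E; apply: H;
  [split=> n /E|split=> Hv; apply: contrapT => /E].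
Qed.

Lemma bd_setCb s A : bd (setCb s A) = bd A.
Proof. by case: s; rewrite //= bdC. Qed.

Lemma bdI A B : bd (A `&` B) `<=` bd A `|` bd B.
Proof.
move=> v [w vw H]; apply: contrapT => /not_orP [nA nB]; apply: H.
have := bd_out vw nA; have := bd_out vw nB; rewrite /=; tauto.
Qed.

(** The empty path joins every vertex to itself, even outside [P]; hence membership of the starting
    vertex is a separate hypothesis where it matters. *)
Definition conn P := clos_refl_trans V (fun v w => [/\ adj v w, P v & P w]).

Lemma conn_in P v w : conn P v w -> P v -> P w.
Proof. by elim=> [x y []|x|x y z _ xy _ yz] // /xy /yz. Qed.

Lemma conn_sub P Q v w : P `<=` Q -> conn P v w -> conn Q v w.
Proof.
move=> PQ; elim=> [x y [xy Px Py]|x|x y z _ xy _ yz]; last exact: rt_trans xy yz.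
  by apply: rt_step; split=> //; apply: PQ.
exact: rt_refl.
Qed.

Lemma conn_const A P v w : conn P v w -> P `&` bd A = set0 -> (A v <-> A w).
Proof.
move=> vw /disjoints_subset PA.
by elim: vw => [x y [xy Px _]|x|x y z _ -> _ ->] //; apply: bd_out => // /PA.
Qed.

Hypothesis connT : forall v w, clos_refl_trans V adj v w.

Lemma connT_const A v w : bd A = set0 -> (A v <-> A w).
Proof.
move=> A0; apply: (@conn_const A setT); last by rewrite A0 setI0.
elim: (connT v w) => [x y xy|x|x y z _ xy _ yz]; last exact: rt_trans xy yz.
  exact: rt_step.
exact: rt_refl.
Qed.

Lemma bd_neq0 A v w : A v -> ~ A w -> bd A !=set0.
Proof.
by move=> Av nAw; apply/set0P/negP => /eqP /(@connT_const A v w) [] /(_ Av).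
Qed.

(** An edge leaving the intersection leaves [A] or [B], so its inner endpoint lies in [FA], hence
    outside [B], or in [FB], hence outside [A]. A nonempty intersection would have such an edge,
    because it misses the points of [FB]. *)
Lemma bd_separated A B FA FB : bd A `<=` FA -> bd B `<=` FB ->
  FA `<=` ~` B -> FB `<=` ~` A -> FB !=set0 -> A `&` B = set0.
Proof.
move=> bA bB FAB FBA [f FBf]; apply/seteqP; split=> // v [Av Bv].
have nI : ~ (A `&` B) f by move=> [/FBA].
have [x [y xy xyI]] := @bd_neq0 (A `&` B) v f (conj Av Bv) nI.
wlog [Ix nIy] : x y xy xyI / (A `&` B) x /\ ~ (A `&` B) y.
  move=> W; have [Ix|nIx] := pselect ((A `&` B) x).
    by apply: (W x y) => //; split=> // Iy; apply: xyI.
  apply: (W y x); [exact: adjC|tauto|]; split=> //.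
  by apply: contrapT => nIy; apply: xyI.
case: Ix => Ax Bx; have [Ay|nAy] := pselect (A y).
  by apply: (FBA x) => //; apply: bB; exists y => // -[/(_ Bx) By _]; apply: nIy.
by apply: (FAB x) => //; apply: bA; exists y => // -[/(_ Ax)].
Qed.

Definition finite_connected F v :=
  [/\ finite_set F, F v & forall w, F w -> conn F v w].

(** Walk from [v] to [w] and adjoin the vertices of the walk one at a time. *)
Lemma finite_connected_add F v w : finite_connected F v ->
  exists F', [/\ finite_connected F' v, F `<=` F' & F' w].
Proof.
have /clos_rt_rtn1_iff := connT v w.
elim=> [|x y xy _ IH] cF; first by exists F; split=> //; case: cF.
have [F' [[fF' F'v cF'] FF' F'x]] := IH cF.
exists (F' `|` [set y]); split; [split|..].
- by rewrite finite_setU; split=> //; exact: finite_set1.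
- by left.
- have sub : F' `<=` F' `|` [set y] by left.
  move=> z [F'z|->]; first exact: conn_sub (cF' z F'z).
  apply: (@rt_trans _ _ _ x); first exact: conn_sub (cF' x F'x).
  by apply: rt_step; split=> //; [left|right].
- by move=> z Fz; left; exact: FF'.
- by right.
Qed.

Lemma finite_connected_hull S v : finite_set S ->
  exists2 F, finite_connected F v & S `<=` F.
Proof.
move=> /finite_seqP [s ->]; elim: s => [|w s [F cF sF]].
  exists [set v] => //; split=> // _ ->; exact: rt_refl.
have [F' [cF' FF' F'w]] := finite_connected_add w cF.
exists F' => // x /=; rewrite in_cons => /orP [/eqP ->//|xs].
by apply: FF'; apply: sF.
Qed.

End Boundary.

(** * Actions on Cayley-Abels graphs *)

Section Compactness.
Context {T : topologicalType}.

Lemma compact_finite_cover (I : Type) (K : set T) (U : I -> set T) :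
  compact K -> (forall i, open (U i)) -> K `<=` \bigcup_i U i ->
  exists2 D : set I, finite_set D & K `<=` \bigcup_(i in D) U i.
Proof.
move=> /compact_near_coveringP cK oU KU.
(* The filter of sufficiently large finite index sets; near-covering for it yields a single finite
   index set that serves all of [K]. *)
pose F := filter_from [set D : set I | finite_set D]
  (fun D => [set E : set I | D `<=` E]).
have FF : Filter F.
  apply: filter_from_filter; first by exists set0; exact: finite_set0.
  move=> D E fD fE; exists (D `|` E); first by rewrite /= finite_setU.
  by move=> X DEX; split=> i Hi; apply: DEX; [left|right].
have [x Kx|D fD DK] := cK _ F (fun D x => (\bigcup_(i in D) U i) x) FF.
  have [i _ Uix] := KU x Kx.
  exists (U i, [set E : set I | E i]) => /=.
    split; first exact: open_nbhs_nbhs.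
    by exists [set i] => //= E; apply.
  by move=> [y E] [/= Uiy Ei]; exists i.
by exists D => //; apply: DK => /=.
Qed.

Lemma bigcup_finite_compact (I : Type) (D : set I) (K : I -> set T) :
  finite_set D -> (forall i, compact (K i)) -> compact (\bigcup_(i in D) K i).
Proof.
move=> fD cK; have /finite_seqP [s Ds] : @finite_set {classic I} D by [].
rewrite Ds; elim: s {Ds} => [|i s IH].
  by rewrite set_nil bigcup_set0; exact: compact0.
rewrite (_ : \bigcup_(_ in _) _ = K i `|` \bigcup_(j in [set` s]) K j).
  exact: compactU.
apply/seteqP; split=> x.
  by move=> [j /=]; rewrite in_cons => /orP [/eqP ->|js] Kx; [left|right; exists j].
move=> [Kx|[j js Kx]]; first by exists i => //=; rewrite in_cons eqxx.
by exists j => //=; rewrite in_cons; apply/orP; right.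
Qed.

Lemma bigcap_finite_open (I : Type) (D : set I) (U : I -> set T) :
  finite_set D -> (forall i, open (U i)) -> open (\bigcap_(i in D) U i).
Proof.
move=> fD cK; have /finite_seqP [s Ds] : @finite_set {classic I} D by [].
rewrite Ds; elim: s {Ds} => [|i s IH].
  by rewrite set_nil bigcap_set0; exact: openT.
rewrite (_ : \bigcap_(_ in _) _ = U i `&` \bigcap_(j in [set` s]) U j).
  exact: openI.
apply/seteqP; split=> x.
  move=> H; split; first by apply: H => /=; rewrite in_cons eqxx.
  by move=> j js; apply: H => /=; rewrite in_cons; apply/orP; right.
by move=> [Ux H] j /=; rewrite in_cons => /orP [/eqP ->|js] //; exact: H.
Qed.
End Compactness.

Section GroupFacts.
Context {G : topologicalType} (g : tgroup G).
Local Notation "x * y" := (gmul g x y).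
Local Notation "1" := (gone g).
Local Notation "x ^-1" := (ginv g x).

Lemma gmul1l x : 1 * x = x. Proof. by case: (gmul1 g x). Qed.
Lemma gmul1r x : x * 1 = x. Proof. by case: (gmul1 g x). Qed.
Lemma gmulVl x : x^-1 * x = 1. Proof. by case: (gmulV g x). Qed.
Lemma gmulVr x : x * x^-1 = 1. Proof. by case: (gmulV g x). Qed.
Lemma gmulKl x y : x^-1 * (x * y) = y.
Proof. by rewrite gmulA gmulVl gmul1l. Qed.
Lemma gmulVKl x y : x * (x^-1 * y) = y.
Proof. by rewrite gmulA gmulVr gmul1l. Qed.
Lemma gmulKr x y : (y * x) * x^-1 = y.
Proof. by rewrite -gmulA gmulVr gmul1r. Qed.
Lemma ginv_uniq x y : x * y = 1 -> y = x^-1.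
Proof. by move=> xy; rewrite -[LHS](gmulKl x) xy gmul1r. Qed.
Lemma ginvK x : (x^-1)^-1 = x.
Proof. by apply/esym/ginv_uniq/gmulVl. Qed.
Lemma ginvM x y : (x * y)^-1 = y^-1 * x^-1.
Proof. by apply/esym/ginv_uniq; rewrite -gmulA gmulVKl gmulVr. Qed.
Lemma ginv1 : 1^-1 = 1.
Proof. by apply/esym/ginv_uniq/gmul1l. Qed.

Lemma gmull_cont a : continuous (gmul g a).
Proof.
move=> x; apply: (@continuous_comp _ _ _ (fun y => (a, y)) (fun p => p.1 * p.2)).
  by apply: cvg_pair; [exact: cvg_cst|exact: cvg_id].
exact: gmul_cont.
Qed.

Lemma gmulr_cont a : continuous (fun x => x * a).
Proof.
move=> x; apply: (@continuous_comp _ _ _ (fun y => (y, a)) (fun p => p.1 * p.2)).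
  by apply: cvg_pair; [exact: cvg_id|exact: cvg_cst].
exact: gmul_cont.
Qed.

Lemma open_gmull a (U : set G) : open U -> open [set x | U (a * x)].
Proof. by move=> oU; apply: open_comp oU => x _; exact: gmull_cont. Qed.

Lemma open_gmulr a (U : set G) : open U -> open [set x | U (x * a)].
Proof. by move=> oU; apply: open_comp oU => x _; exact: gmulr_cont. Qed.

Lemma open_ginv (U : set G) : open U -> open [set x | U (x^-1)].
Proof. by move=> oU; apply: open_comp oU => x _; exact: ginv_cont. Qed.

Lemma compact_image_cont (f : G -> G) (K : set G) : continuous f -> compact K ->
  compact (f @` K).
Proof.
by move=> cf cK; apply: continuous_compact => //; apply: continuous_subspaceT.
Qed.

Lemma compact_gmull a (K : set G) : compact K -> compact [set x | K (a * x)].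
Proof.
move=> cK; rewrite (_ : [set x | _] = gmul g (a^-1) @` K).
  by apply: compact_image_cont => //; exact: gmull_cont.
apply/seteqP; split=> [x Kx|_ [y Ky <-]] /=; last by rewrite gmulVKl.
by exists (a * x) => //; rewrite gmulKl.
Qed.

End GroupFacts.

Section DinfHom.
Context {G : topologicalType} (g : tgroup G).
Local Notation "x * y" := (gmul g x y).
Local Notation "1" := (gone g).
Local Notation "x ^-1" := (ginv g x).

Lemma dmul_canl x y z : dmul x y = dmul x z -> y = z.
Proof.
case: x y z => [a s] [b t] [c u]; rewrite /dmul /=; case: s => -[] E.
  by move/(congr1 negb); rewrite !negbK => ->; congr pair; lia.
by move=> ->; congr pair; lia.
Qed.

Context (phi : G -> Dinf) (phiM : forall x y, phi (x * y) = dmul (phi x) (phi y)).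

Lemma dhom1 : phi 1 = done.
Proof.
apply: (@dmul_canl (phi 1)); rewrite -phiM gmul1l /dmul /done /=.
by case: (phi 1) => a [] /=; rewrite ?oppr0 addr0.
Qed.

Lemma dhom_fiber x y : phi x = phi y <-> phi (x^-1 * y) = done.
Proof.
have -> : phi y = dmul (phi x) (phi (x^-1 * y)) by rewrite -phiM gmulVKl.
have E : dmul (phi x) done = phi x.
  by rewrite /dmul /done; case: (phi x) => a [] /=; rewrite ?oppr0 addr0.
split=> [H|->]; last by rewrite E.
by apply: (@dmul_canl (phi x)); rewrite E.
Qed.

Lemma dhom_fiber_open (W : set G) d : open W -> W 1 ->
  (forall x, W x -> phi x = done) -> open (phi @^-1` [set d]).
Proof.
move=> oW W1 Wphi; rewrite openE => x /= <-.
rewrite /interior nbhsE /=; exists [set y | W (x^-1 * y)].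
  by split; [exact: open_gmull|rewrite /= gmulVl].
by move=> y /Wphi /dhom_fiber ->.
Qed.

Lemma dhom_fiber_closed d : (forall d, open (phi @^-1` [set d])) ->
  closed (phi @^-1` [set d]).
Proof.
move=> o; rewrite -[X in closed X]setCK; apply: open_closedC.
rewrite (_ : ~` _ = \bigcup_(e in [set~ d]) (phi @^-1` [set e])).
  by apply: bigcup_open => e _.
by apply/seteqP; split=> [x nx|x [e ne /= ->]] //; exists (phi x).
Qed.

Lemma dhom_fiber_compact d : compact (phi @^-1` [set done]) ->
  compact (phi @^-1` [set d]).
Proof.
move=> cK; have [[x xd]|nd] := pselect (exists x, phi x = d); last first.
  rewrite (_ : _ @^-1` _ = set0); first exact: compact0.
  by apply/seteqP; split=> // x xd; apply: nd; exists x.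
rewrite (_ : _ @^-1` _ = [set y | (phi @^-1` [set done]) (x^-1 * y)]).
  exact: compact_gmull.
apply/seteqP; split=> y /=; first by rewrite -xd => /esym /dhom_fiber.
by rewrite -xd => /dhom_fiber.
Qed.

End DinfHom.

Section Action.
Context {G : topologicalType} (g : tgroup G).
Local Notation "x * y" := (gmul g x y).
Local Notation "1" := (gone g).
Local Notation "x ^-1" := (ginv g x).
Context {V : choiceType} (adj : V -> V -> Prop) (act : G -> V -> V).
Hypothesis CA : cayley_abels g adj act.
Implicit Types A F : set V.

Lemma ca_sym v w : adj v w -> adj w v.
Proof. by case: CA => _ [[H _] _]; exact: H. Qed.

Lemma ca_irr v : ~ adj v v.
Proof. by case: CA => _ [[_ H] _]; exact: H. Qed.

Lemma ca_conn v w : clos_refl_trans V adj v w.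
Proof. by case: CA => _ [_ [H _]]; exact: H. Qed.

Lemma ca_locfin v : finite_set [set w | adj v w].
Proof. by case: CA => _ [_ [_ [H _]]]; exact: H. Qed.

Lemma ca_act1 v : act 1 v = v.
Proof. by case: CA => _ [_ [_ [_ [[H _] _]]]]; exact: H. Qed.

Lemma ca_actM x y v : act (x * y) v = act x (act y v).
Proof. by case: CA => _ [_ [_ [_ [[_ [H _]] _]]]]; exact: H. Qed.

Lemma ca_adj x v w : adj v w <-> adj (act x v) (act x w).
Proof. by case: CA => _ [_ [_ [_ [[_ [_ H]] _]]]]; exact: H. Qed.

Lemma ca_trans v w : exists x, act x v = w.
Proof. by case: CA => _ [_ [_ [_ [_ [H _]]]]]; exact: H. Qed.

Lemma ca_actK x : cancel (act x) (act x^-1).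
Proof. by move=> v; rewrite -ca_actM gmulVl ca_act1. Qed.

Lemma ca_actVK x : cancel (act x^-1) (act x).
Proof. by move=> v; rewrite -ca_actM gmulVr ca_act1. Qed.

Lemma ca_mover v w x : act x v = w ->
  [set y | act y v = w] = [set y | [set z | act z v = v] (x^-1 * y)].
Proof.
move=> xvw; apply/seteqP; split=> y /=; rewrite ca_actM.
  by move=> ->; rewrite -xvw ca_actK.
by move=> H; rewrite -[LHS](ca_actVK x) H.
Qed.

Lemma ca_open v w : open [set x | act x v = w].
Proof.
have [x xvw] := ca_trans v w; rewrite (ca_mover xvw); apply: open_gmull.
by case: CA => _ [_ [_ [_ [_ [_ H]]]]]; case: (H v).
Qed.

Lemma ca_compact v w : compact [set x | act x v = w].
Proof.
have [x xvw] := ca_trans v w; rewrite (ca_mover xvw); apply: compact_gmull.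
by case: CA => _ [_ [_ [_ [_ [_ H]]]]]; case: (H v).
Qed.

(** The open sets of elements carrying [v] to a given vertex are nonempty and partition the group,
    so compactness leaves finitely many. *)
Lemma ca_compact_finite : compact [set: G] -> finite_set [set: V].
Proof.
move=> cG; case: (CA) => -[v] _.
have [|D fD GD] := compact_finite_cover cG (fun w => ca_open v w).
  by move=> x _; exists (act x v).
apply: sub_finite_set fD => w _; have [x xvw] := ca_trans v w.
by have [w' Dw' /= E] := GD x I; rewrite -xvw E.
Qed.

Lemma ca_finite_compact : finite_set [set: V] -> compact [set: G].
Proof.
move=> fV; case: (CA) => -[v] _.
rewrite (_ : setT = \bigcup_(w in [set: V]) [set x | act x v = w]).
  by apply: bigcup_finite_compact => // w; exact: ca_compact.
by apply/seteqP; split=> // x _; exists (act x v).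
Qed.

Definition translate x A : set V := act x^-1 @^-1` A.

Lemma translateM x y A : translate (x * y) A = translate x (translate y A).
Proof. by apply/seteqP; split=> v; rewrite /translate /= ginvM ca_actM. Qed.

Lemma translate_setCb x s A : translate x (setCb s A) = setCb s (translate x A).
Proof. by case: s. Qed.

Lemma bd_translate x A : bd adj (translate x A) = translate x (bd adj A).
Proof.
apply/seteqP; split=> v [w vw H].
  by exists (act x^-1 w) => //; apply/(ca_adj x); rewrite !ca_actVK.
exists (act x w); first by apply/(ca_adj x^-1); rewrite ca_actK.
by rewrite /translate /= ca_actK.
Qed.

(** * The homomorphism to the infinite dihedral group *)

Section EndsToDinf.
Context (A : set V).
Hypotheses (fbdA : finite_set (bd adj A)) (infA : infinite_set A)
  (infCA : infinite_set (~` A))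
  (dichA : forall x, exists s, almost_eq A (setCb s (translate x A))).

Definition end_sign x : bool := `[< almost_eq A (setCb true (translate x A)) >].

(** If [A] were almost equal both to a translate and to the complement of that translate, the
    complement of [A] would be finite. *)
Lemma end_sign_uniq x s : almost_eq A (setCb s (translate x A)) ->
  s = end_sign x.
Proof.
rewrite /end_sign; case: s => H; first by apply/esym/asboolT.
apply/esym/asboolF => -[_ K]; case: H => /= [L M].
apply: infCA; apply: (@sub_finite_set _ _
  ((~` translate x A `\` A) `|` (translate x A `\` A))).
  by move=> v nA; have [|] := pselect (translate x A v); [right|left].
by rewrite finite_setU.
Qed.

Lemma end_signP x : almost_eq A (setCb (end_sign x) (translate x A)).
Proof. by have [s Hs] := dichA x; rewrite -(end_sign_uniq Hs). Qed.

Lemma almost_eq_translate x B C : almost_eq B C ->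
  almost_eq (translate x B) (translate x C).
Proof.
apply: (@almost_eq_preimage _ (act x^-1) (act x)); [exact: ca_actVK|exact: ca_actK].
Qed.

Lemma end_sign_step x y : almost_eq (setCb (end_sign x) (translate x A))
  (setCb (end_sign x (+) end_sign y) (translate (x * y) A)).
Proof.
rewrite translateM -setCbD -(translate_setCb x (end_sign y)); apply: almost_eq_setCb.
by apply: almost_eq_translate; exact: end_signP.
Qed.

Lemma end_signM x y : end_sign (x * y) = end_sign x (+) end_sign y.
Proof.
apply/esym/end_sign_uniq; apply: almost_eq_trans (end_sign_step x y).
exact: end_signP.
Qed.

(* [G] acts on the sets almost equal to [A] by translation, composed with
   complementation when the ends are exchanged; [idx] measures where a set lies
   in this family, and the action is by translations and reflections of [idx]. *)
Definition end_hom x : Dinf :=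
  (idx A (setCb (end_sign x) (translate x A)), end_sign x).

Lemma end_homM x y : end_hom (x * y) = dmul (end_hom x) (end_hom y).
Proof.
rewrite /end_hom /dmul /= end_signM; congr pair.
(* Passing from [A] to its image under [x], and from there to the image under [x * y]: the second
   stage is the one for [y] moved by [x], so its index changes at most by the sign of [x]. *)
rewrite (idx_trans (end_signP x) (end_sign_step x y)); congr (_ + _)%R.
rewrite translateM -setCbD -(translate_setCb x (end_sign y)) idx_setCb.
rewrite (@idx_preimage _ (act x^-1) (act x)) //; last exact: end_signP.
  exact: ca_actVK.
exact: ca_actK.
Qed.

Lemma end_bd_neq0 : bd adj A !=set0.
Proof.
have [v Av] := infinite_setN0 infA; have [w nAw] := infinite_setN0 infCA.
exact: (bd_neq0 ca_conn Av nAw).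
Qed.

Lemma end_hom_ker_open : exists W : set G,
  [/\ open W, W 1 & forall x, W x -> end_hom x = done].
Proof.
exists (\bigcap_(v in bd adj A) [set x | act x v = v]); split.
- by apply: bigcap_finite_open => // v; exact: ca_open.
- by move=> v _; exact: ca_act1.
move=> x fix_x.
have fixV v : bd adj A v -> act x^-1 v = v.
  by move=> bv; rewrite -{1}(fix_x v bv) ca_actK.
have bdV v : bd adj (translate x A) v -> bd adj A v.
  rewrite bd_translate => bv.
  by rewrite -(ca_actVK x v) (fix_x _ bv).
suff E : translate x A = A.
  have s0 : false = end_sign x.
    by apply: end_sign_uniq; rewrite /= E; exact: almost_eq_refl.
  by rewrite /end_hom -s0 /= E /idx subrr.
(* [P] contains the boundary of [A], which [x] fixes pointwise. Along an edge with an endpoint off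
   that boundary neither set changes. So [P] has empty boundary, and by connectedness it is
   everything. *)
pose P := [set v | A v <-> translate x A v].
have P_bd v : bd adj A v -> P v by move=> /fixV E; rewrite /P /translate /= E.
have P0 : bd adj P = set0.
  apply/seteqP; split=> // v [w vw H]; apply: H.
  have wv := ca_sym vw.
  have [bv|nbv] := pselect (bd adj A v); last first.
    have h1 := bd_out vw nbv.
    have h2 : translate x A v <-> translate x A w by apply: (bd_out vw) => /bdV.
    rewrite /P /=; tauto.
  have [bw|nbw] := pselect (bd adj A w); first by split=> _; exact: P_bd.
  have h1 := bd_out wv nbw.
  have h2 : translate x A w <-> translate x A v by apply: (bd_out wv) => /bdV.
  rewrite /P /=; tauto.
have [b bb] := end_bd_neq0.
have PT v : P v by apply/(connT_const ca_conn v b P0); exact: P_bd.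
by apply/seteqP; split=> v; apply PT.
Qed.

Lemma end_hom_ker_meets F v : finite_connected adj F v -> bd adj A `<=` F ->
  forall x, end_hom x = done -> exists u w, [/\ F u, F w & act x u = w].
Proof.
move=> [fF Fv cF] bF x [phi0 s0]; apply: contrapT => ndis.
have dis w : F w -> ~ F (act x^-1 w).
  by move=> Fw Fxw; apply: ndis; exists (act x^-1 w), w; rewrite ca_actVK.
set B := translate x A; rewrite s0 /= -/B in phi0.
have AB : almost_eq A B by have := end_signP x; rewrite s0.
(* A connected set that misses the boundary of [C] lies on one side of [C]. *)
have constF C : F `&` bd adj C = set0 -> exists s, F `<=` setCb s C.
  move=> FC; have [Cv|nCv] := pselect (C v).
    by exists false => w Fw; apply/(conn_const (cF w Fw) FC).
  by exists true => w Fw /(conn_const (cF w Fw) FC).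
have [s Fs] : exists s, F `<=` setCb s B.
  apply: constF; apply/seteqP; split=> // w [Fw].
  by rewrite bd_translate => /bF; exact: dis.
(* The same for the moved hull and [A], obtained by pulling back along [x]. *)
have [t Ft] : exists t, translate x F `<=` setCb t A.
  have [|t Ft] := constF (translate x^-1 A).
    apply/seteqP; split=> // w [Fw]; rewrite bd_translate /translate /= ginvK.
    by move=> /bF Fxw; apply: (dis _ Fxw); rewrite ca_actK.
  exists t => w /Ft; rewrite -translate_setCb /translate /= ginvK ca_actVK.
  exact.
have sC u (C : set V) : setCb u C = ~` setCb (~~ u) C.
  by case: u; rewrite //= setCK.
(* On each side take the part that misses the hull of the other set; these two parts are
   disjoint. *)
have I0 : setCb (~~ t) A `&` setCb (~~ s) B = set0.
  apply: (@bd_separated _ _ ca_sym ca_conn _ _ F (translate x F)).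
  - by rewrite bd_setCb.
  - by rewrite bd_setCb bd_translate => w; exact: bF.
  - by rewrite -sC.
  - by rewrite -sC.
  - by exists (act x v); rewrite /translate /= ca_actK.
(* Equality would place the boundary of [A] in [F] and in its translate, which are disjoint. *)
have neqAB : A <> B.
  move=> E; have [b bb] := end_bd_neq0.
  apply: (dis _ (bF _ bb)); apply: bF.
  by rewrite {1}E bd_translate in bb.
(* If [A] and [B], or their complements, are disjoint, almost equality contradicts infinity. In the
   two mixed cases the sets are nested with index zero, hence equal. *)
case: t {Ft} I0; case: s {Fs} => /=.
- by move=> I0; apply: (almost_eq_infinite AB infA); rewrite I0.
- rewrite -setDE setD_eq0 => sAB.
  by apply: neqAB; exact: idx0_subset.
- rewrite setIC -setDE setD_eq0 => sBA.
  apply/neqAB/esym/idx0_subset => //; first exact: almost_eq_sym.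
  by rewrite idx_antisym phi0 oppr0.
- move=> I0; apply: (almost_eq_infinite (almost_eqC AB) infCA).
  by rewrite I0.
Qed.

(** The kernel is closed and lies in the compact set of elements carrying some point of a finite
    hull of the boundary into that hull. If the image were finite, [G] would be a finite union of
    compact fibres and the graph would be finite. *)
Lemma ends_to_Dinf : exists phi : G -> Dinf,
  [/\ forall x y, phi (x * y) = dmul (phi x) (phi y),
      forall d, open (phi @^-1` [set d]),
      compact (phi @^-1` [set done]) & infinite_set (range phi)].
Proof.
have oF d : open (end_hom @^-1` [set d]).
  have [W [oW W1 WK]] := end_hom_ker_open.
  exact: (dhom_fiber_open end_homM _ oW W1 WK).
have cK : compact (end_hom @^-1` [set done]).
  have [v _] := end_bd_neq0.
  have [F cF bF] := finite_connected_hull ca_conn v fbdA.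
  pose K := \bigcup_(p in F `*` F) [set x | act x p.1 = p.2].
  apply: (@subclosed_compact _ _ K); first exact: dhom_fiber_closed.
    apply: bigcup_finite_compact; last by move=> p; exact: ca_compact.
    by case: cF => fF _ _; exact: finite_setX.
  move=> x /(end_hom_ker_meets cF bF) [u [w [Fu Fw xuw]]].
  by exists (u, w).
exists end_hom; split=> //; first exact: end_homM.
move=> fR; have /ca_compact_finite fV : compact [set: G].
  rewrite (_ : setT = \bigcup_(d in range end_hom) (end_hom @^-1` [set d])).
    apply: bigcup_finite_compact => // d.
    by apply: (dhom_fiber_compact end_homM).
  by apply/seteqP; split=> // x _; exists (end_hom x) => //; exists x.
by apply: infA; apply: sub_finite_set fV.
Qed.

End EndsToDinf.
End Action.

(** * Infinite subgroups of the infinite dihedral group *)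

Section DinfImage.
Context {G : topologicalType} (g : tgroup G).
Local Notation "x * y" := (gmul g x y).
Local Notation "1" := (gone g).
Local Notation "x ^-1" := (ginv g x).
Context (phi : G -> Dinf) (phiM : forall x y, phi (x * y) = dmul (phi x) (phi y)).

Definition trans_part (n : int) := exists x, phi x = (n, false).

Lemma trans_part0 : trans_part 0%R.
Proof. by exists 1; exact: dhom1. Qed.

Lemma trans_partD m n : trans_part m -> trans_part n -> trans_part (m + n)%R.
Proof. by move=> [x xm] [y yn]; exists (x * y); rewrite phiM xm yn. Qed.

Lemma trans_partN n : trans_part n -> trans_part (- n)%R.
Proof.
move=> [x xn]; exists x^-1; have := phiM x^-1 x.
rewrite gmulVl (dhom1 phiM) xn; case: (phi _) => b [] //=.
by rewrite /dmul /done /= => -[E]; congr pair; lia.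
Qed.

Lemma trans_partMz n k : trans_part n -> trans_part (n * k)%R.
Proof.
have nat_case (m : nat) (i : int) : trans_part i -> trans_part (i * m%:Z)%R.
  move=> Ti; elim: m => [|m IH]; first by rewrite mulr0; exact: trans_part0.
  by rewrite -addn1 PoszD mulrDr mulr1; exact: trans_partD.
move=> Tn; case: k => k; first exact: nat_case.
by rewrite NegzE mulrN; apply/trans_partN/nat_case.
Qed.

Lemma refl_part x y a b : phi x = (a, true) -> phi y = (b, true) ->
  trans_part (a - b)%R.
Proof. by move=> xa yb; exists (x * y); rewrite phiM xa yb. Qed.

(** The least positive translation divides all others, by division with remainder. *)
Lemma trans_part_cyclic : infinite_set (range phi) ->
  exists2 k : int, (k != 0)%R & forall n, trans_part n <-> (k %| n)%Z.
Proof.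
move=> iR.
have [m m0 Tm] : exists2 n : nat, (0 < n)%N & trans_part n%:Z.
  apply: contrapT => nT.
  have T0 n : trans_part n -> n = 0%R.
    move=> Tn; apply: contrapT => /eqP n0; apply: nT; exists `|n|%N.
      by rewrite absz_gt0.
    have [E|E] : Posz `|n|%N = n \/ Posz `|n|%N = (- n)%R by lia.
      by rewrite E.
    by rewrite E; exact: trans_partN.
  (* Without a nonzero translation all reflections coincide, as two of them differ by a translation;
     the image then has at most two elements. *)
  apply: iR; have [[x0 r0]|nr] := pselect (exists x, (phi x).2 = true).
    apply: (@sub_finite_set _ _ [set done; phi x0]); last exact: finite_set2.
    move=> _ [x _ <-]; case Ex: (phi x) => [a []].
      right; case E0: (phi x0) r0 => [b s] /= sT; rewrite sT in E0.
      by congr pair; have := T0 _ (refl_part Ex E0); lia.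
    by left; rewrite (T0 a) //; exists x.
  apply: (@sub_finite_set _ _ [set done]); last exact: finite_set1.
  move=> _ [x _ <-]; case Ex: (phi x) => [a []].
    by case: nr; exists x; rewrite Ex.
  by rewrite (T0 a) //; exists x.
have exT : exists n, [pred n : nat | (0 < n)%N && `[< trans_part n%:Z >]] n.
  by exists m; rewrite /= m0; apply/asboolP.
case: (ex_minnP exT) => k /andP [k0 /asboolP Tk] kmin.
exists (Posz k); first by lia.
move=> n; split=> [Tn|/dvdzP [q ->]]; last by rewrite mulrC; exact: trans_partMz.
have Tr : trans_part (n %% k%:Z)%Z.
  have -> : (n %% k%:Z)%Z = (n + - (k%:Z * (n %/ k%:Z)%Z))%R by rewrite /modz; ring.
  by apply: trans_partD => //; apply/trans_partN/trans_partMz.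
apply/dvdz_mod0P; apply: contrapT => /eqP r0.
have k0z : Posz k != 0%R by lia.
have rge := modz_ge0 n k0z.
have rlt := ltz_mod n k0z.
have := kmin `|(n %% k%:Z)%Z|%N; rewrite /= gez0_abs //.
move=> /(_ _)/wrap [|H]; last by lia.
by apply/andP; split; [lia|apply/asboolP].
Qed.

(** Divide by the generator [k] of the translations. If there is a reflection, take its centre as
    the origin: the map sending [(n, s)] to [n * k], plus [a0] when [s] holds, is an injective
    endomorphism of [Dinf] onto the image. The kernel is unchanged in both cases. *)
Lemma Dinf_image_cases : (forall d, open (phi @^-1` [set d])) ->
  compact (phi @^-1` [set done]) -> infinite_set (range phi) ->
  onto_Z_compact_open_kernel g \/ onto_Dinf_compact_open_kernel g.
Proof.
move=> oF cK /trans_part_cyclic [k k0 Tk].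
have dvd_trans x a : phi x = (a, false) -> (k %| a)%Z.
  by move=> xa; apply/Tk; exists x.
have [[x0 r0]|nr] := pselect (exists x, (phi x).2 = true); [right|left].
  case E0: (phi x0) r0 => [a0 s] /= sT; rewrite sT {s sT} in E0.
  have dvd_refl x a : phi x = (a, true) -> (k %| (a - a0)%R)%Z.
    by move=> xa; apply/Tk; exact: refl_part xa E0.
  have [psi phiE] : exists psi : G -> Dinf, forall x, phi x =
      ((psi x).1 * k + if (psi x).2 then a0 else 0, (psi x).2)%R.
    exists (fun x => ((((phi x).1 - if (phi x).2 then a0 else 0)%R %/ k)%Z,
      (phi x).2)) => x; case E: (phi x) => [a []] /=.
      by rewrite divzK ?subrK //; exact: dvd_refl E.
    by rewrite subr0 divzK ?addr0 //; exact: dvd_trans E.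
  have fiber n s : psi @^-1` [set (n, s)] =
      phi @^-1` [set (n * k + if s then a0 else 0, s)%R].
    apply/seteqP; split=> x /=; first by rewrite phiE => ->.
    rewrite phiE => -[/[swap] E]; rewrite E => /addIr /(mulIf k0) E'.
    by rewrite -E' -E; case: (psi x).
  have kerE : psi @^-1` [set done] = phi @^-1` [set done].
    by rewrite fiber mul0r addr0.
  exists psi; split.
  - move=> x y; have := phiM x y; rewrite 3!phiE /dmul /=.
    case: (psi (x * y)) => n u; case: (psi x) => a s; case: (psi y) => b t /=.
    move=> -[/[swap] ->]; case: s; case: t => /= E; congr pair;
      apply: (mulIf k0); rewrite ?mulrDl ?mulNr; lia.
  - by move=> [n s]; rewrite fiber.
  - move=> [n s].
    have [y yE] : trans_part (n * k)%R by rewrite mulrC; apply/trans_partMz/Tk.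
    suff [x xE] : exists x, phi x = (n * k + if s then a0 else 0, s)%R.
      by exists x; have : (psi @^-1` [set (n, s)]) x by rewrite fiber.
    case: s; first by exists (y * x0); rewrite phiM yE E0.
    by exists y; rewrite addr0.
  - have := oF done; rewrite -kerE; exact.
  - have := cK; rewrite -kerE; exact.
pose psi x := ((phi x).1 %/ k)%Z.
have phiE x : phi x = (psi x * k, false)%R.
  rewrite /psi; case E: (phi x) => [a []] /=; first by case: nr; exists x; rewrite E.
  by rewrite divzK //; exact: dvd_trans E.
have fiber n : psi @^-1` [set n] = phi @^-1` [set (n * k, false)%R].
  apply/seteqP; split=> x /=; first by rewrite phiE => ->.
  by rewrite phiE => -[/(mulIf k0)].
have kerE : psi @^-1` [set 0%R] = phi @^-1` [set done] by rewrite fiber mul0r.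
exists psi; split.
- move=> x y; have := phiM x y; rewrite 3!phiE /dmul /= => -[E].
  by apply: (mulIf k0); rewrite mulrDl.
- by move=> n; rewrite fiber.
- move=> n; have [x xE] : trans_part (n * k)%R.
    by rewrite mulrC; apply/trans_partMz/Tk.
  by exists x; have : (psi @^-1` [set n]) x by rewrite fiber.
- have := oF done; rewrite -kerE; exact.
- have := cK; rewrite -kerE; exact.
Qed.

End DinfImage.

(** * The line *)

Lemma infinite_range (T : Type) (f : nat -> T) : injective f -> infinite_set (range f).
Proof.
move=> fI; have E : (range f #= [set: nat])%card.
  by apply: inj_card_eq => x y _ _; exact: fI.
by rewrite (eq_finite_set E); exact: infinite_nat.
Qed.

Lemma degree_le1 (V : choiceType) (S : set V) e x y : (S #= `I_e)%card ->
  (e < 2)%N -> S x -> S y -> x = y.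
Proof.
move=> Se e2 Sx Sy; apply: contrapT => /eqP xy.
have fS : finite_set S by apply/finite_setP; exists e.
have := fsubset_leq_card (A := [fset x; y]%fset) (B := fset_set S).
rewrite cardfs2 xy (card_fset_set Se) => H; suff : (2 <= e)%N by lia.
by apply: H; apply/fsubsetP => z; rewrite !inE in_fset_set // => /orP [] /eqP ->;
  apply: mem_set.
Qed.

Lemma card_set2 (V : choiceType) (x y : V) : x != y -> ([set x; y] #= `I_2)%card.
Proof.
move=> xy; have -> : [set x; y] = [set` [fset x; y]%fset].
  apply/seteqP; split=> z /=; first by move=> [->|->]; rewrite !inE eqxx ?orbT.
  by rewrite !inE => /orP [] /eqP ->; [left|right].
by apply/card_eq_fsetP; rewrite cardfs2 xy.
Qed.

Section Powers.
Context {G : topologicalType} (g : tgroup G).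
Local Notation "x * y" := (gmul g x y).
Local Notation "x ^-1" := (ginv g x).

Lemma gpowN c n : gpow g c (- n)%R = (gpow g c n)^-1.
Proof.
case: n => [[|n]|n]; first by rewrite oppr0 /= ginv1.
  by rewrite (_ : (- _)%R = Negz n).
by rewrite NegzE opprK /= ginvK.
Qed.

Lemma iter_gmul_comm c n : c * iter n (gmul g c) (gone g) =
  iter n (gmul g c) (gone g) * c.
Proof.
elim: n => [|n IH]; first by rewrite gmul1l gmul1r.
by rewrite iterS -gmulA -IH.
Qed.

Lemma gpow_succ c n : gpow g c (n + 1)%R = c * gpow g c n.
Proof.
case: n => [n|n]; first by rewrite -PoszD addn1.
rewrite (_ : (Negz n + 1)%R = (- Posz n)%R); last by rewrite NegzE; lia.
by rewrite gpowN /= iter_gmul_comm ginvM gmulVKl.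
Qed.

Lemma gpowD c m n : gpow g c (m + n)%R = gpow g c m * gpow g c n.
Proof.
have pos (k : nat) i : gpow g c (Posz k + i)%R = gpow g c k * gpow g c i.
  elim: k => [|k IH]; first by rewrite add0r gmul1l.
  by rewrite -addn1 PoszD addrAC !gpow_succ IH gmulA.
case: m => m; first exact: pos.
rewrite NegzE gpowN; have := pos m.+1 (- Posz m.+1 + n)%R.
by rewrite addrA subrr add0r => ->; rewrite gmulKl.
Qed.

End Powers.

Definition line (m n : int) : Prop := (n = m + 1 \/ m = n + 1)%R.

Lemma line_nbrs m : [set n | line m n] = [set (m + 1)%R; (m - 1)%R].
Proof. by apply/seteqP; split=> n /=; rewrite /line; lia. Qed.

Lemma line_degree : graph_degree line 2.
Proof. by move=> m; rewrite line_nbrs; apply: card_set2; lia. Qed.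

(** Injectivity forbids turning back, so the first step determines the direction of the ray. *)
Lemma line_ray r : is_ray line r ->
  (forall n, r n = r 0%N + Posz n)%R \/ (forall n, r n = r 0%N - Posz n)%R.
Proof.
move=> [rI rS].
have back n : (r n.+2 <> r n) by move=> /rI; lia.
have [r1|r1] := rS 0; [left|right].
  suff H n : (r n = r 0%N + Posz n /\ r n.+1 = r 0%N + Posz n.+1)%R.
    by move=> n; case: (H n).
  elim: n => [|n [IH1 IH2]]; first by rewrite r1; split; lia.
  by split=> //; have := back n; case: (rS n.+1); lia.
suff H n : (r n = r 0%N - Posz n /\ r n.+1 = r 0%N - Posz n.+1)%R.
  by move=> n; case: (H n).
elim: n => [|n [IH1 IH2]]; first by split; lia.
by split=> //; have := back n; case: (rS n.+1); lia.
Qed.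

Lemma line_two_ended : two_ended_graph line.
Proof.
have rayP (a : int) : is_ray line (fun n => a + Posz n)%R.
  by split=> [m n|n]; rewrite /line; lia.
have rayN (a : int) : is_ray line (fun n => a - Posz n)%R.
  by split=> [m n|n]; rewrite /line; lia.
exists (fun n => 0 + Posz n)%R, (fun n => 0 - Posz n)%R; split=> //.
  move=> [r [rr []]].
  (* Rays of opposite directions share only integers between the starting point and 0, a bounded
     set. *)
  have fin N (S : set int) : S `<=` [set i | `|i| <= N]%N -> finite_set S.
    move=> SN; apply: (@sub_finite_set _ _
      ((fun k : nat => Posz k - Posz N)%R @` `I_(N + N).+1)).
      move=> i /SN /= iN; exists `|(i + Posz N)%R|%N; rewrite /=; lia.
    exact: finite_image.
  have [E|E] := line_ray rr => i1 i2.
    apply: i2; apply: (fin `|r 0%N|%N) => _ [[n _ <-] [m _ /=]]; rewrite E; lia.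
  apply: i1; apply: (fin `|r 0%N|%N) => _ [[n _ <-] [m _ /=]]; rewrite E; lia.
move=> r rr.
have rI : infinite_set (range r `&` range r).
  by rewrite setIid; apply: infinite_range; case: rr.
have [E|E] := line_ray rr; [left|right]; exists r; split=> //; split=> //.
  (* Beyond the absolute value of [r 0], both rays run through all integers. *)
  apply: (@sub_infinite_set _ (range (fun n => Posz (`|r 0| + n)%N))).
    move=> _ [n _ <-]; split; last by exists (`|r 0%N| + n)%N; rewrite ?add0r.
    exists `|(Posz (`|r 0| + n)%N - r 0%N)%R|%N; rewrite // E; lia.
  by apply: infinite_range => m n; lia.
apply: (@sub_infinite_set _ (range (fun n => - Posz (`|r 0| + n)%N)%R)).
  move=> _ [n _ <-]; split; last by exists (`|r 0%N| + n)%N; rewrite ?add0r.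
  exists `|(Posz (`|r 0| + n)%N + r 0%N)%R|%N; rewrite // E; lia.
by apply: infinite_range => m n; lia.
Qed.

Lemma line_conn m n : clos_refl_trans int line m n.
Proof.
have up (k : nat) i : clos_refl_trans int line i (i + Posz k)%R.
  elim: k => [|k IH]; first by rewrite addr0; exact: rt_refl.
  by apply: rt_trans IH _; apply: rt_step; rewrite /line; lia.
have dn (k : nat) i : clos_refl_trans int line i (i - Posz k)%R.
  elim: k => [|k IH]; first by rewrite subr0; exact: rt_refl.
  by apply: rt_trans IH _; apply: rt_step; rewrite /line; lia.
have [mn|mn] := leP m n.
  by rewrite (_ : n = m + Posz `|(n - m)%R|%N)%R; [exact: up|lia].
by rewrite (_ : n = m - Posz `|(m - n)%R|%N)%R; [exact: dn|lia].
Qed.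

Section Line.
Context {G : topologicalType} (g : tgroup G).
Local Notation "x * y" := (gmul g x y).
Local Notation "1" := (gone g).
Local Notation "x ^-1" := (ginv g x).

(** The isometric action on the integers: [(a, true)] is the reflection sending [n] to [a - n]. *)
Definition dact (d : Dinf) (n : int) : int := (d.1 + if d.2 then - n else n)%R.

Lemma dactM d e n : dact (dmul d e) n = dact d (dact e n).
Proof.
by case: d e => [a s] [b t]; rewrite /dact /dmul /=; case: s; case: t => /=; lia.
Qed.

(** The translations in [Dinf] are a copy of the integers, so both cases give a homomorphism to
    [Dinf] whose image contains all translations; this is the surjectivity used below. *)
Lemma cases_Dinf_hom :
  onto_Z_compact_open_kernel g \/ onto_Dinf_compact_open_kernel g ->
  exists phi : G -> Dinf,
  [/\ forall x y, phi (x * y) = dmul (phi x) (phi y),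
      forall d, open (phi @^-1` [set d]),
      compact (phi @^-1` [set done]) &
      forall n, exists x, phi x = (n, false)].
Proof.
case=> [[phi [phiM oF surj _ cK]]|[phi [phiM oF surj _ cK]]]; last by exists phi.
exists (fun x => (phi x, false)); split=> //.
- by move=> x y; rewrite phiM.
- move=> [n []].
    by rewrite (_ : _ @^-1` _ = set0) //; [exact: open0|apply/seteqP; split].
  rewrite (_ : _ @^-1` _ = phi @^-1` [set n]) //.
  by apply/seteqP; split=> x /= => [[]|->].
- rewrite (_ : _ @^-1` _ = [set x | phi x = 0%R]) //.
  by apply/seteqP; split=> x /= => [[]|->].
- by move=> n; have [x <-] := surj n; exists x.
Qed.

Context (phi : G -> Dinf) (phiM : forall x y, phi (x * y) = dmul (phi x) (phi y)).
Hypotheses (oF : forall d, open (phi @^-1` [set d]))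
  (cK : compact (phi @^-1` [set done]))
  (surj : forall n, exists x, phi x = (n, false)).

Lemma line_cayley_abels : cayley_abels g line (fun x => dact (phi x)).
Proof.
split; first exact: (inhabits 0%R).
split; first by split=> [v w|v]; rewrite /line; lia.
split; first exact: line_conn.
split; first by move=> v; rewrite line_nbrs; exact: finite_set2.
split.
  split; first by move=> v; rewrite (dhom1 phiM) /dact /= add0r.
  split; first by move=> x y v; rewrite phiM dactM.
  by move=> x v w; rewrite /line /dact; case: (phi x) => a [] /=; lia.
split.
  by move=> v w; have [x xE] := surj (w - v)%R; exists x; rewrite xE /dact /= subrK.
(* Only the identity and the reflection [(v + v, true)] fix [v]. *)
move=> v; rewrite (_ : [set x | _] =
    (phi @^-1` [set done]) `|` (phi @^-1` [set (v + v, true)%R])).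
  by split; [exact: openU|apply: compactU => //; exact: dhom_fiber_compact cK].
apply/seteqP; split=> x /=; rewrite /dact /done; case: (phi x) => a [] /=.
- by move=> E; right; congr pair; lia.
- by move=> E; left; congr pair; lia.
- by case=> -[]; lia.
- by case=> -[]; lia.
Qed.

Lemma line_not_compact : ~ compact [set: G].
Proof.
move=> /(ca_compact_finite line_cayley_abels) fV.
suff : infinite_set [set: int] by [].
apply: (@sub_infinite_set _ (range Posz)) => //.
by apply: infinite_range => m n; lia.
Qed.

Lemma Dinf_hom_two_ended : two_ended g.
Proof.
exists int, line, (fun x => dact (phi x)); split; first exact: line_cayley_abels.
exact: line_two_ended.
Qed.

(** A connected graph of degree at most 1 consists of a vertex and its neighbours. It is finite, and
    its group would be compact, which the action on the infinite line excludes. *)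
Lemma Dinf_hom_md_eq2 : md_eq g 2.
Proof.
split.
  exists int, line, (fun x => dact (phi x)); split; first exact: line_cayley_abels.
  exact: line_degree.
move=> V adj act e CA deg; apply: contrapT => /negP; rewrite -ltnNge => e2.
apply: line_not_compact; apply: (@ca_finite_compact _ _ {classic V} _ _ CA).
have [[v0] _] := CA.
have fN : finite_set ([set v0] `|` [set w | adj v0 w]).
  rewrite finite_setU; split; first exact: finite_set1.
  exact: (@ca_locfin _ _ {classic V} _ _ CA).
apply: sub_finite_set fN => w _.
have /clos_rt_rtn1_iff := (@ca_conn _ _ {classic V} _ _ CA) v0 w.
elim=> [|x y xy _ [<-|v0x]]; [by left|by right|left].
apply: (@degree_le1 {classic V} [set w | adj x w] e) => //.
exact: (@ca_sym _ _ {classic V} _ _ CA).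
Qed.

(** A preimage [c] of the unit translation generates the subgroup; the open fibres isolate its
    powers. *)
Lemma Dinf_hom_cocompact : has_cocompact_discrete_Z g.
Proof.
have [c cE] := surj 1%R.
have powE n : phi (gpow g c n) = (n, false).
  have pos (k : nat) : phi (gpow g c k) = (Posz k, false).
    elim: k => [|k IH]; first exact: dhom1.
    by rewrite -addn1 PoszD gpow_succ phiM IH cE /dmul /= addrC.
  case: n => n //; apply: (@dmul_canl (phi (gpow g c n.+1))).
  rewrite -phiM NegzE gpowN gmulVr (dhom1 phiM) pos /dmul /done /=.
  by congr pair; lia.
exists c; split.
- apply: (@sub_infinite_set _ (range (fun n : nat => gpow g c n))).
    by move=> _ [n _ <-]; exists (Posz n).
  by apply: infinite_range => m n /(congr1 phi); rewrite !powE => -[].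
- move=> _ [n ->]; exists (phi @^-1` [set (n, false)]); split=> //.
  apply/seteqP; split=> [x [/= + [m xE]]|_ ->] /=; first by rewrite xE powE => -[->].
  by split; [rewrite powE|exists n].
- move=> I U HU cov.
  (* A compact set meeting every coset of the cyclic subgroup: multiplying by a power of [c] on the
     right brings the translation component to 0. *)
  pose K := (phi @^-1` [set done]) `|` (phi @^-1` [set (0, true)%R]).
  have cK' : compact K by apply: compactU => //; exact: dhom_fiber_compact cK.
  have [||D fD KD] := @compact_finite_cover _ _ K U cK'.
  + by move=> i; case: (HU i).
  + by rewrite -cov.
  exists D; split=> //; apply/seteqP; split=> // x _.
  have [m Km] : exists m, K (x * gpow g c m).
    case E: (phi x) => [a s]; exists (if s then a else - a)%R.
    rewrite /K /= phiM powE E /dmul /done /=.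
    by case: s {E}; [right|left]; rewrite subrr.
  have [i Di Ui] := KD _ Km; exists i => //.
  have := (HU i).2 _ (gpow g c (- m)%R) Ui; rewrite gpowN gmulKr; apply.
  by exists (- m)%R; rewrite gpowN.
Qed.

End Line.

(** * Rays and ends *)

Lemma finite_nat_bounded (S : set nat) : finite_set S ->
  exists N, forall n, S n -> (n < N)%N.
Proof.
move=> /finite_seqP [s ->]; elim: s => [|m s [N HN]]; first by exists 0.
exists (maxn m.+1 N) => n /=; rewrite in_cons => /orP [/eqP ->|/HN]; lia.
Qed.

(** Applied to rays, which are injective, and to half-orbits of the cyclic group. *)
Lemma finite_fibers_eventually (V : Type) (f : nat -> V) (S : set V) :
  (forall v, finite_set [set n | f n = v]) -> finite_set S ->
  exists N, forall n, (N <= n)%N -> ~ S (f n).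
Proof.
move=> fF fS.
have [|N HN] := @finite_nat_bounded (\bigcup_(v in S) [set n | f n = v]).
  by apply: bigcup_finite => // v _.
exists N => n Nn Sn; have := HN n; rewrite ltnNge Nn => H.
by suff : false by []; apply: H; exists (f n).
Qed.

Section Rays.
Context {V : choiceType} (adj : V -> V -> Prop).
Hypothesis adjC : forall v w, adj v w -> adj w v.
Hypothesis connT : forall v w, clos_refl_trans V adj v w.
Hypothesis locfin : forall v, finite_set [set w | adj v w].
Implicit Types (A B P S : set V) (r : nat -> V).

Definition eventually_in P r := exists N, forall n, (N <= n)%N -> P (r n).

Lemma ray_leaves S r : is_ray adj r -> finite_set S -> eventually_in (~` S) r.
Proof.
move=> [rI _]; apply: finite_fibers_eventually => v.
have [[m <-]|nv] := pselect (exists m, r m = v).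
  by apply: (@sub_finite_set _ _ [set m]) => // n /= /rI.
by apply: (@sub_finite_set _ _ set0) => // n /= nE; apply: nv; exists n.
Qed.

(** Once the ray has left the boundary for good, its membership in [P] no longer changes. *)
Lemma ray_eventually P r : finite_set (bd adj P) -> is_ray adj r ->
  eventually_in P r \/ eventually_in (~` P) r.
Proof.
move=> fP rr; have [N HN] := ray_leaves rr fP.
have E n : P (r (N + n)%N) <-> P (r N).
  elim: n => [|n IH]; first by rewrite addn0.
  rewrite -IH addnS; apply: iff_sym; apply: (@bd_out _ adj).
    by case: rr => _; apply.
  by apply: HN; lia.
have {}E n : (N <= n)%N -> P (r n) <-> P (r N).
  by move=> Nn; rewrite -(subnKC Nn).
have [PN|nPN] := pselect (P (r N)); [left|right]; exists N => n /E En.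
  exact/En.
by move=> /En.
Qed.

Lemma eventually_inI P Q r : eventually_in P r -> eventually_in Q r ->
  eventually_in (P `&` Q) r.
Proof.
move=> [N HN] [M HM]; exists (maxn N M) => n Hn.
by split; [apply: HN|apply: HM]; lia.
Qed.

Lemma eventually_in0 r : ~ eventually_in set0 r.
Proof. by move=> [N /(_ N (leqnn N))]. Qed.

Lemma eventually_in_contra P r : eventually_in P r -> ~ eventually_in (~` P) r.
Proof.
by move=> h1 h2; have := eventually_inI h1 h2; rewrite setICr; exact: eventually_in0.
Qed.

Lemma eventually_in_sub P Q r : P `<=` Q -> eventually_in P r -> eventually_in Q r.
Proof. by move=> PQ [N HN]; exists N => n /HN /PQ. Qed.

Lemma eventually_in_infinite P r : is_ray adj r -> eventually_in P r -> infinite_set P.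
Proof.
move=> [rI _] [N HN]; apply: (@sub_infinite_set _ (range (fun n => r (N + n)%N))).
  by move=> _ [n _ <-]; apply: HN; lia.
by apply: infinite_range => m n /rI; lia.
Qed.

Lemma ray_meets_eventually P r q : finite_set (bd adj P) -> is_ray adj q ->
  infinite_set (range q `&` range r) -> eventually_in P r -> eventually_in P q.
Proof.
move=> fP rq inf [N HN]; have [//|[M HM]] := ray_eventually fP rq.
case: inf; apply: (@sub_finite_set _ _ ((q @` `I_M) `|` (r @` `I_N))).
  move=> v [[m _ mv] [n _ nv]].
  have [mM|Mm] := ltnP m M; first by left; exists m.
  have [nN|Nn] := ltnP n N; first by right; exists n.
  by case: (HM _ Mm); rewrite mv -nv; exact: HN.
by rewrite finite_setU; split; exact: finite_image.
Qed.

Lemma ray_equiv_eventually P r q : finite_set (bd adj P) -> is_ray adj r ->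
  is_ray adj q -> ray_equiv adj r q -> eventually_in P r -> eventually_in P q.
Proof.
move=> fP rr rq [p [rp [pr pq]]] Pr.
apply: (ray_meets_eventually fP rq (r := p)); first by rewrite setIC.
exact: (ray_meets_eventually fP rp pr).
Qed.

(** A path from [v0] to a point of [P] enters [P] for the last time at a boundary vertex, unless it
    never leaves [P]. So finitely many components cover [P], and one is infinite. *)
Lemma konig_start P : infinite_set P -> finite_set (bd adj P) ->
  exists2 v, P v & infinite_set [set w | conn adj P v w].
Proof.
move=> iP fP; have [v0 Pv0] := infinite_setN0 iP.
apply: contrapT => nx.
have fC v : P v -> finite_set [set w | conn adj P v w].
  by move=> Pv; apply: contrapT => iC; apply: nx; exists v.
apply: iP; apply: (@sub_finite_set _ _ ([set w | conn adj P v0 w] `|`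
  \bigcup_(b in bd adj P `&` P) [set w | conn adj P b w])); last first.
  rewrite finite_setU; split; first exact: fC.
  apply: bigcup_finite; first exact: finite_setIl.
  by move=> b [_ /fC].
move=> w; have /clos_rt_rtn1_iff := connT v0 w.
elim=> [_|x y xy _ IH Py]; first by left; exact: rt_refl.
have [Px|nPx] := pselect (P x); last first.
  right; exists y; last exact: rt_refl.
  by split=> //; exists x; [exact: adjC|tauto].
have yx : conn adj P x y by apply: rt_step.
by have [cx|[b Hb cx]] := IH Px; [left|right; exists b => //]; exact: rt_trans cx yx.
Qed.

(** After its last visit to [v], a path in the component continues from a neighbour of [v] and
    avoids [v]; there are finitely many neighbours. *)
Lemma konig_step P S v : infinite_set [set w | conn adj (P `\` S) v w] ->
  exists w, [/\ adj v w, (P `\` (S `|` [set v])) w &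
    infinite_set [set u | conn adj (P `\` (S `|` [set v])) w u]].
Proof.
set S' := S `|` [set v] => inf; apply: contrapT => nx.
pose D := [set w | adj v w] `&` (P `\` S').
apply: inf; apply: (@sub_finite_set _ _ ([set v] `|`
  \bigcup_(w in D) [set u | conn adj (P `\` S') w u])); last first.
  rewrite finite_setU; split; first exact: finite_set1.
  apply: bigcup_finite; first exact: finite_setIl.
  move=> w [vw PSw]; apply: contrapT => iw; apply: nx.
  by exists w; split.
move=> y /clos_rt_rtn1_iff; elim=> [|x z [xz [Px nSx] [Pz nSz]] _ IH]; first by left.
have [->|/eqP zv] := eqVneq z v; first by left.
right; have nS'z : ~ S' z by case.
case: IH => [xv|[w Dw wx]].
  by exists z; [split=> //=; rewrite -xv|exact: rt_refl].
exists w => //; apply: (rt_trans _ _ _ _ _ wx); apply: rt_step; split=> //.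
by apply: conn_in wx _; case: Dw.
Qed.

Lemma konig P : infinite_set P -> finite_set (bd adj P) ->
  exists2 r, is_ray adj r & forall n, P (r n).
Proof.
move=> iP fP; have [v0 Pv0 i0] := konig_start iP fP.
(* A state holds the set of visited vertices and the current vertex, whose component outside the
   visited set is infinite. *)
pose inv (x : set V * V) := (P `\` x.1) x.2 /\
  infinite_set [set w | conn adj (P `\` x.1) x.2 w].
pose R (x y : {x | inv x}) := (sval y).1 = (sval x).1 `|` [set (sval x).2] /\
  adj (sval x).2 (sval y).2.
have step (x : {x | inv x}) : {y | R x y}.
  apply/cid; case: x => [[S v] [/= PSv iS]].
  have [w [vw PSw iw]] := konig_step iS.
  by exists (exist inv (S `|` [set v], w) (conj PSw iw)).
have inv0 : inv (set0, v0) by split; [split|rewrite /= setD0].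
have [f [f0 fS]] := dependent_choice step (exist inv (set0, v0) inv0).
pose r n := (sval (f n)).2.
have used m n : (m < n)%N -> (sval (f n)).1 (r m).
  elim: n => // n IH mn; rewrite (fS n).1.
  have [->|mn'] := eqVneq m n; first by right.
  by left; apply: IH; lia.
have rP n : (P `\` (sval (f n)).1) (r n) by case: (svalP (f n)).
exists r; last by move=> n; case: (rP n).
split=> [m n mn|n]; last exact: (fS n).2.
by have [/used|/used|//] := ltngtP m n; [rewrite mn|rewrite -mn] => u;
  [case: (rP n)|case: (rP m)].
Qed.

(** An edge leaving a component of the complement of [S] ends in [S], so the boundary lies in [S]
    and its neighbours. *)
Lemma bd_component S v : finite_set S ->
  finite_set (bd adj [set w | conn adj (~` S) v w]) \/ S v.
Proof.
move=> fS; have [Sv|nSv] := pselect (S v); [by right|left].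
set C := [set w | _].
have CS w : C w -> ~ S w by move=> Cw; exact: (conn_in Cw nSv).
have out x y : adj x y -> C x -> ~ C y -> S y.
  move=> xy Cx nCy; apply: contrapT => nSy; apply: nCy.
  by apply: (rt_trans _ _ _ _ _ Cx); apply: rt_step; split=> //; exact: CS.
apply: (@sub_finite_set _ _ (S `|` \bigcup_(y in S) [set x | adj y x])); last first.
  by rewrite finite_setU; split=> //; apply: bigcup_finite.
move=> x [y xy nCC]; have [Cx|nCx] := pselect (C x).
  right; exists y; last exact: adjC.
  by apply: (out x) => // Cy; apply: nCC.
left; apply: (out y) => //; first exact: adjC.
by apply: contrapT => nCy; apply: nCC; split=> // /nCy.
Qed.

Definition adjb : rel V := fun v w => `[< adj v w >].

Lemma conn_path P v w : conn adj P v w -> P v ->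
  exists t, [/\ path adjb v t, uniq (v :: t), last v t = w &
    forall u, u \in v :: t -> P u].
Proof.
move=> /clos_rt_rtn1_iff vw Pv.
have [t [pt lt Pt]] : exists t, [/\ path adjb v t, last v t = w &
    forall u, u \in v :: t -> P u].
  elim: vw => [|x y [xy Px Py] _ [t [pt lt Pt]]].
    by exists [::]; split=> // u; rewrite inE => /eqP ->.
  exists (rcons t y); split; first by rewrite rcons_path pt lt; apply/asboolP.
    by rewrite last_rcons.
  move=> u; rewrite -rcons_cons mem_rcons in_cons => /orP [/eqP ->//|]; exact: Pt.
move: lt; case: (shortenP pt) => t' pt' ut' st' lt'.
exists t'; split=> // u; rewrite in_cons => /orP [/eqP ->//|/st' ut].
by apply: Pt; rewrite in_cons ut orbT.
Qed.

(* A simple path that can be prolonged along the ray [r]. *)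
Definition good r x0 (s : seq V) := [/\ path adjb x0 s, uniq (x0 :: s) &
  exists2 k, last x0 s = r k & forall n, (k < n)%N -> r n \notin x0 :: s].

(** The tail of [r] beyond [s] lies in one component [C] of the complement of [s]. Its boundary is
    finite, so [q] also ends up in [C], and a path inside [C] leads from [r] to [q] without touching
    [s]. *)
Lemma good_step r q x0 s : is_ray adj r -> is_ray adj q ->
  (forall A, finite_set (bd adj A) -> eventually_in A r -> eventually_in A q) ->
  good r x0 s -> exists2 t, (0 < size t)%N & good q x0 (s ++ t).
Proof.
move=> rr rq rsq [ps us [k lk tk]].
set S := [set` x0 :: s].
have fS : finite_set S by exact: finite_seq.
have nS n : (k < n)%N -> ~ S (r n) by move=> kn; apply/negP; exact: tk.
set C := [set w | conn adj (~` S) (r k.+1) w].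
have fC : finite_set (bd adj C).
  by have [//|] := bd_component (r k.+1) fS => /nS; case.
have Cr : eventually_in C r.
  exists k.+1 => n kn; rewrite -(subnKC kn); elim: (n - k.+1)%N => [|m IH].
    by rewrite addn0; exact: rt_refl.
  apply: rt_trans IH _; apply: rt_step; rewrite addnS.
  by split; [case: rr => _; exact|apply: nS; lia|apply: nS; lia].
have [N HN] := rsq C fC Cr.
have nSk := nS k.+1 (ltnSn k).
have [t [pt ut lt tS]] := conn_path (HN N (leqnn N)) nSk.
have CS w : C w -> ~ S w by move=> Cw; exact: (conn_in Cw nSk).
(* The path is cut at [q m] for the last index [m] with [q m] on it, so the rest of [q] avoids the
   path. As the path ends at [q N], [m] is at least [N] and this rest stays in [C]. *)
have [M HM] := ray_leaves rq (finite_seq (r k.+1 :: t)).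
have exm : exists m, q m \in r k.+1 :: t by exists N; rewrite -lt mem_last.
have [|m qm mmax] := @ex_maxnP [pred m | q m \in r k.+1 :: t] M exm.
  by move=> i /= qi; rewrite leqNgt; apply/negP => Mi; apply: (HM i); [lia|].
have Nm : (N <= m)%N by apply: mmax; rewrite /= -lt mem_last.
move: pt ut tS mmax {lt exm HM}.
case: (splitPl qm) => t1 t2 lt1; rewrite cat_path -cat_cons cat_uniq.
move=> /andP [pt1 _] /andP [ut1 _] tS mmax.
exists (r k.+1 :: t1) => //; split.
- rewrite cat_path ps /= pt1 andbT lk; apply/asboolP.
  by case: rr => _; exact.
- rewrite -cat_cons cat_uniq us ut1 andbT andTb.
  apply/hasPn => u ut; apply/negP => uS; apply: (tS u) => //.
  by rewrite mem_cat ut.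
- exists m; first by rewrite last_cat.
  move=> n mn; rewrite -cat_cons mem_cat negb_or; apply/andP; split.
    by apply/negP; apply: CS; apply: HN; lia.
  apply/negP => qn; suff : (n <= m)%N by lia.
  by apply: mmax; rewrite inE mem_cat qn.
Qed.

(** If no set with finite boundary separates the rays, a simple path can be prolonged alternately to
    [r1] and to [r2]. The limit of these paths is a third ray meeting both infinitely often. *)
Lemma rays_separated r1 r2 : is_ray adj r1 -> is_ray adj r2 ->
  ~ ray_equiv adj r1 r2 -> exists A, [/\ finite_set (bd adj A),
    eventually_in A r1 & eventually_in (~` A) r2].
Proof.
move=> rr1 rr2 neq; apply: contrapT => nsep; apply: neq.
have s12 A : finite_set (bd adj A) -> eventually_in A r1 -> eventually_in A r2.
  move=> fA A1; have [//|A2] := ray_eventually fA rr2.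
  by case: nsep; exists A.
have s21 A : finite_set (bd adj A) -> eventually_in A r2 -> eventually_in A r1.
  move=> fA A2; have [//|A1] := ray_eventually fA rr1.
  case: (eventually_in_contra A2); apply: s12 => //; by rewrite bdC.
pose x0 := r1 0; pose rb (b : bool) := if b then r2 else r1.
(* A state is a simple path from [x0] together with the ray on which it ends. *)
pose inv (x : seq V * bool) := good (rb x.2) x0 x.1.
pose R (x y : {x | inv x}) := (sval y).2 = ~~ (sval x).2 /\
  exists2 t, (0 < size t)%N & (sval y).1 = (sval x).1 ++ t.
have step (x : {x | inv x}) : {y | R x y}.
  apply/cid; case: x => [[s b] /= gs].
  have [t t0 gt] : exists2 t, (0 < size t)%N & good (rb (~~ b)) x0 (s ++ t).
    by case: b gs => gs; [apply: (good_step rr2 rr1)|apply: (good_step rr1 rr2)].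
  by exists (exist inv (s ++ t, ~~ b) gt); split=> //; exists t.
have inv0 : inv ([::], false).
  split=> //; exists 0 => // n n0; rewrite inE; apply/eqP => E.
  by case: rr1 => rI _; move: (rI _ _ E); lia.
have [f [f0 fS]] := dependent_choice step (exist inv ([::], false) inv0).
pose s n := (sval (f n)).1.
have sS n : exists2 t, (0 < size t)%N & s n.+1 = s n ++ t by case: (fS n).
have bE n : (sval (f n)).2 = odd n.
  by elim: n => [|n IH]; [rewrite f0|rewrite (fS n).1 IH].
have gs n : good (rb (odd n)) x0 (s n) by rewrite -bE; exact: (svalP (f n)).
have mono m n : (m < n)%N -> (size (s m) < size (s n))%N.
  elim: n => // n IH mn; have [t t0 ->] := sS n; rewrite size_cat.
  by have [->|mn'] := eqVneq m n; [lia|have := IH ltac:(lia); lia].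
have szge n : (n <= size (s n))%N.
  by elim: n => // n IH; have := mono n n.+1 (ltnSn n); lia.
have pre m n : (m <= n)%N -> exists t, s n = s m ++ t.
  elim: n => [|n IH] mn; first by exists [::]; rewrite cats0; congr s; lia.
  have [->|mn'] := eqVneq m n.+1; first by exists [::]; rewrite cats0.
  have [|t Et] := IH; first by lia.
  by have [t' _ ->] := sS n; exists (t ++ t'); rewrite Et catA.
(* The [n]th path has at least [n] edges and later paths extend it, so its [n]th vertex is final. *)
pose r n := nth x0 (x0 :: s n) n.
have rE n j : (n <= size (s j))%N -> nth x0 (x0 :: s j) n = r n.
  have E a b : (a <= b)%N -> (n <= size (s a))%N ->
      nth x0 (x0 :: s b) n = nth x0 (x0 :: s a) n.
    by move=> /pre [t ->] na; rewrite -cat_cons nth_cat /= ltnS na.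
  by move=> nj; have [/E ->|/ltnW /E <-] := leqP n j; rewrite ?szge.
have rI : injective r.
  have H m n : (m <= n)%N -> r m = r n -> m = n.
    move=> mn; have := szge n => sn.
    rewrite -(rE m n) -?(rE n n) //; last by lia.
    by move=> /eqP; rewrite nth_uniq /=; [move/eqP|lia|lia|case: (gs n)].
  by move=> m n E; have [/H ->|/ltnW /H <-] := leqP m n.
have rr : is_ray adj r.
  split=> // n; have sn := szge n.+1.
  rewrite -(rE n n.+1) -?(rE n.+1 n.+1) //; last by lia.
  by case: (gs n.+1) => /(pathP x0) /(_ n sn) /asboolP.
have rlast j : range (rb (odd j)) (r (size (s j))).
  have [_ _ [k lk _]] := gs j; exists k => //.
  by rewrite -lk -(rE _ j) // (last_nth x0).
have inf (h : nat -> nat) : {homo h : m n / (m < n)%N} ->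
    infinite_set (range (fun n => r (size (s (h n))))).
  move=> hm; apply: infinite_range => m n /rI.
  by have [/hm /mono|/hm /mono|//] := ltngtP m n; lia.
exists r; split=> //; split.
  apply: (sub_infinite_set _ (inf double _)); last by move=> m n; lia.
  move=> _ [n _ <-]; split; first by eexists.
  by have := rlast n.*2; rewrite odd_double.
apply: (sub_infinite_set _ (inf (fun n => n.*2.+1) _)); last by move=> m n; lia.
move=> _ [n _ <-]; split; first by eexists.
by have := rlast n.*2.+1; rewrite /= odd_double.
Qed.

(** For a set with finite boundary: it carries at most one end, as no finite boundary cuts it into
    two infinite pieces. *)
Definition end_like A := forall B, finite_set (bd adj B) ->
  finite_set (A `&` B) \/ finite_set (A `\` B).

(** An infinite piece of [A] with finite boundary contains a ray by König's lemma. That ray is not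
    equivalent to [r2], hence is equivalent to [r1], so [r1] ends up in the piece; it cannot end up
    in two disjoint pieces. *)
Lemma two_ended_end_like r1 r2 A : is_ray adj r1 -> is_ray adj r2 ->
  (forall r, is_ray adj r -> ray_equiv adj r r1 \/ ray_equiv adj r r2) ->
  finite_set (bd adj A) -> eventually_in (~` A) r2 -> end_like A.
Proof.
move=> rr1 rr2 all fA A2 B fB; apply: contrapT => /not_orP [i1 i2].
have bdI2 C : finite_set (bd adj C) -> finite_set (bd adj (A `&` C)).
  move=> fC; apply: sub_finite_set (@bdI _ adj A C) _.
  by rewrite finite_setU.
have ev1 C : finite_set (bd adj C) -> infinite_set (A `&` C) ->
    eventually_in (A `&` C) r1.
  move=> fC iC; have fAC := bdI2 _ fC; have [q rq qAC] := konig iC fAC.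
  have qev : eventually_in (A `&` C) q by exists 0.
  have [e|e] := all q rq; first exact: (ray_equiv_eventually fAC rq rr1 e).
  have /eventually_in_contra := ray_equiv_eventually fAC rq rr2 e qev.
  by case; apply: eventually_in_sub A2 => v nA [].
have h1 := ev1 B fB i1.
have h2 : eventually_in (A `&` ~` B) r1 by apply: ev1 => //; rewrite bdC.
apply: (@eventually_in0 r1); apply: eventually_in_sub (eventually_inI h1 h2).
by move=> v [[_ Bv] [_]].
Qed.

Lemma two_ended_split : two_ended_graph adj -> exists A,
  [/\ finite_set (bd adj A), infinite_set A, infinite_set (~` A), end_like A &
    end_like (~` A)].
Proof.
move=> [r1 [r2 [rr1 rr2 neq all]]].
have [A [fA A1 A2]] := rays_separated rr1 rr2 neq.
exists A; split=> //.
- exact: eventually_in_infinite A1.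
- exact: eventually_in_infinite A2.
- exact: (two_ended_end_like rr1 rr2).
- apply: (two_ended_end_like rr2 rr1); rewrite ?bdC ?setCK //.
  by move=> r /all; tauto.
Qed.

Lemma ray_end_like r A : is_ray adj r -> A `<=` range r -> end_like A.
Proof.
move=> rr Ar B fB; have [[N HN]|[N HN]] := ray_eventually fB rr; [right|left];
  apply: (@sub_finite_set _ _ (r @` `I_N)); try exact: finite_image;
  move=> v [/Ar [n _ <-] Bn]; exists n => //=; rewrite ltnNge; apply/negP => /HN.
  by move=> ?; apply: Bn.
by apply.
Qed.

End Rays.

(** * From ends to homomorphisms *)

Section EndLike.
Context {G : topologicalType} (g : tgroup G).
Context {V : choiceType} (adj : V -> V -> Prop) (act : G -> V -> V).
Hypothesis CA : cayley_abels g adj act.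

(** A translate of [A] splits neither [A] nor its complement into infinite pieces. Of the four
    combinations, two would make the translate or its complement finite; the others say that it is
    almost equal to [A] or to the complement of [A]. *)
Lemma end_like_cases (A : set V) : finite_set (bd adj A) -> infinite_set A ->
  infinite_set (~` A) -> end_like adj A -> end_like adj (~` A) ->
  onto_Z_compact_open_kernel g \/ onto_Dinf_compact_open_kernel g.
Proof.
move=> fA iA iCA eA eCA.
have inf_tr x (X : set V) : infinite_set X -> infinite_set (translate g act x X).
  move=> iX fX; apply: iX; apply: sub_finite_set (finite_image (act (ginv g x)) fX).
  by move=> v Xv; exists (act x v); rewrite /translate /= (ca_actK CA).
have [x|phi [phiM oF cK iR]] := ends_to_Dinf CA fA iA iCA; last first.
  exact: Dinf_image_cases iR.
set B := translate g act x A.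
have fB : finite_set (bd adj B).
  rewrite bd_translate //; apply: sub_finite_set (finite_image (act x) fA).
  by move=> v bv; exists (act (ginv g x) v) => //; rewrite (ca_actVK CA).
have iB : infinite_set B by exact: inf_tr.
have iCB : infinite_set (~` B) by exact: (inf_tr x (~` A)).
have fU (X Y Z : set V) : Z `<=` X `|` Y -> finite_set X -> finite_set Y ->
    finite_set Z.
  by move=> ZXY fX fY; apply: sub_finite_set ZXY _; rewrite finite_setU.
have [f1|f1] := eA B fB; have [f2|f2] := eCA B fB.
- case: iB; apply: (fU _ _ _ _ f1 f2) => v Bv.
  by have [Av|nAv] := pselect (A v); [left|right].
- exists true; split; last by apply: sub_finite_set f2 => v [].
  by apply: sub_finite_set f1 => v [Av /= nnBv]; split=> //; apply: contrapT.
- exists false; split; first exact: f1.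
  by apply: sub_finite_set f2 => v [].
- case: iCB; apply: (fU _ _ _ _ f1 f2) => v nBv.
  by have [Av|nAv] := pselect (A v); [left|right].
Qed.

End EndLike.

(** * Infinite two-regular graphs *)

Section TwoRegular.
Context {V : choiceType} (adj : V -> V -> Prop).
Hypothesis adjC : forall v w, adj v w -> adj w v.
Hypothesis adjI : forall v, ~ adj v v.
Hypothesis connT : forall v w, clos_refl_trans V adj v w.
Hypothesis deg2 : graph_degree adj 2.

Lemma deg2_fin v : finite_set [set w | adj v w].
Proof. by apply/finite_setP; exists 2; exact: deg2. Qed.

Lemma deg2_nbr v a b c : adj v a -> adj v b -> a <> b -> adj v c -> c = a \/ c = b.
Proof.
move=> va vb ab vc; apply: contrapT => /not_orP [/eqP ca /eqP cb].
have := fsubset_leq_card (A := [fset c; a; b]%fset)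
  (B := fset_set [set w | adj v w]).
rewrite (card_fset_set (deg2 v)).
have -> : #|` [fset c; a; b]%fset| = 3.
  by rewrite -fsetUA !cardfsU1 cardfs1 !inE; move/eqP: ab => /negPf ->;
    rewrite (negPf ca) (negPf cb).
move=> H; suff : (3 <= 2)%N by []; apply: H; apply/fsubsetP => z.
rewrite !inE in_fset_set; last exact: deg2_fin.
by move=> /orP [/orP []|] /eqP ->; apply: mem_set.
Qed.

Lemma deg2_other v a : exists2 b, adj v b & b <> a.
Proof.
apply: contrapT => nx.
have := fsubset_leq_card (A := fset_set [set w | adj v w]) (B := [fset a]%fset).
rewrite (card_fset_set (deg2 v)) cardfs1 => H; suff : (2 <= 1)%N by [].
apply: H; apply/fsubsetP => z; rewrite in_fset_set; last exact: deg2_fin.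
move=> /set_mem vz; rewrite inE; apply/eqP; apply: contrapT => za.
by apply: nx; exists z.
Qed.

Definition ray_cons (b : V) (r : nat -> V) n := if n is k.+1 then r k else b.

Lemma ray_nbrs r n w : is_ray adj r -> adj (r n.+1) w -> w = r n \/ w = r n.+2.
Proof.
move=> [rI rS]; apply: deg2_nbr => //; first exact: adjC.
by move=> /rI; lia.
Qed.

(** The new vertex cannot lie further along the ray, where each vertex already has both its
    neighbours on the ray. *)
Lemma ray_cons_ray r b : is_ray adj r -> adj (r 0) b -> b <> r 1 ->
  is_ray adj (ray_cons b r).
Proof.
move=> rr rb br; have [rI rS] := rr.
have nb k : r k <> b.
  case: k => [|[|k]] E; [by apply: (@adjI b); rewrite -{1}E|exact: br|].
  have := adjC rb; rewrite -E => /(ray_nbrs rr) [] /rI; lia.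
split=> [[|m] [|n] /=|[|n] /=] //; first by move/esym/nb.
- by move/nb.
- by move/rI ->.
- exact: adjC.
Qed.

(** A ray [r] is prolonged backwards forever, giving a second ray [s] from the same vertex. Together
    they form the whole graph, and the range of [r] is the half-line sought. *)
Lemma two_regular_split : infinite_set [set: V] -> exists A,
  [/\ finite_set (bd adj A), infinite_set A, infinite_set (~` A),
    end_like adj A & end_like adj (~` A)].
Proof.
move=> iV; have bdT : bd adj setT = set0 by apply/seteqP; split=> // v [w _ []].
have [r rr _] : exists2 r, is_ray adj r & forall n, [set: V] (r n).
  by apply: konig => //; [exact: deg2_fin|rewrite bdT].
(* [f n] is [r] with [n] vertices prepended, and [s n] below is its first vertex. *)
pose R (x y : {r | is_ray adj r}) := forall n, sval y n.+1 = sval x n.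
have step (x : {r | is_ray adj r}) : {y | R x y}.
  apply/cid; case: x => q rq; have [b qb bq] := deg2_other (q 0) (q 1).
  by exists (exist _ _ (ray_cons_ray rq qb bq)).
have [f [f0 fS]] := dependent_choice step (exist _ r rr).
have fray n : is_ray adj (sval (f n)) by exact: svalP.
have shift m n k : sval (f (m + n)%N) (m + k)%N = sval (f n) k.
  by elim: m => // m IH; rewrite !addSn fS.
pose s n := sval (f n) 0.
have sE m n : sval (f (m + n)%N) m = s n by have := shift m n 0; rewrite addn0.
have rE n k : sval (f n) (n + k)%N = r k by rewrite -{1}(addn0 n) shift f0.
have s0 : s 0 = r 0 by rewrite /s f0.
have rs : is_ray adj s.
  split=> [m n|n].
    wlog mn : m n / (m <= n)%N.
      by move=> W; have [/W|/ltnW /W H /esym /H] := leqP m n.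
    rewrite -(sE (n - m) m)%N subnK // => /(fray n).1; lia.
  by rewrite /s -(fS n 0); apply: adjC; exact: (fray n.+1).2.
have rNs n k : s n.+1 <> r k.
  by rewrite -(rE n.+1 k) => /(fray n.+1).1.
(* The union of the two rays is closed under adjacency. *)
have cov v : range r v \/ range s v.
  have /clos_rt_rtn1_iff := connT (r 0) v.
  elim=> [|x y xy _ [[k _ kx]|[n _ nx]]]; first by left; exists 0.
    case: k kx xy => [<-|k <-].
      have r01 : adj (r 0) (r 1) by exact: rr.2.
      have s01 : adj (r 0) (s 1) by rewrite -s0; exact: rs.2.
      have neq : r 1 <> s 1 by move/esym/rNs.
      by move=> /(deg2_nbr r01 s01 neq) [] ->; [left; exists 1|right; exists 1].
    by move=> /(ray_nbrs rr) [] ->; left; eexists.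
  case: n nx xy => [<-|n <-].
    have r01 : adj (s 0) (r 1) by rewrite s0; exact: rr.2.
    have s01 : adj (s 0) (s 1) by exact: rs.2.
    have neq : r 1 <> s 1 by move/esym/rNs.
    by move=> /(deg2_nbr r01 s01 neq) [] ->; [left; exists 1|right; exists 1].
  by move=> /(ray_nbrs rs) [] ->; right; eexists.
exists (range r); split.
- apply: (@sub_finite_set _ _ ([set r 0] `|` [set w | adj (r 0) w])).
    have nb k w : adj (r k) w -> ~ range r w -> k = 0.
      by case: k => // k /(ray_nbrs rr) [] -> []; eexists.
    move=> v [w vw H]; have [rv|nrv] := pselect (range r v).
      left; have [k _ kv] := rv; rewrite -kv in vw *.
      by rewrite (nb k w vw) // => rw; apply: H.
    right; have [[k _ kw]|] := pselect (range r w); last by tauto.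
    rewrite -kw in vw; rewrite /= -(nb k v) //; exact: adjC.
  by rewrite finite_setU; split; [exact: finite_set1|exact: deg2_fin].
- exact: infinite_range rr.1.
- apply: (@sub_infinite_set _ (range (fun n => s n.+1))).
    by move=> _ [n _ <-] [k _ /esym /rNs].
  by apply: infinite_range => m n /(rs.1); lia.
- by apply: (ray_end_like rr).
- by apply: (ray_end_like rs) => v nrv; have [|] := cov v.
Qed.

End TwoRegular.

Section Cases12.
Context {G : topologicalType} (g : tgroup G).

(** A compact group acts on the one-vertex graph, which has degree 0. *)
Lemma md_eq2_not_compact : md_eq g 2 -> ~ compact [set: G].
Proof.
move=> [_ min] cG.
suff : (2 <= 0)%N by [].
apply: (min unit (fun _ _ => False) (fun _ v => v)).
  split; first exact: (inhabits tt).
  split; first by split=> // v [].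
  split; first by move=> [] []; exact: rt_refl.
  split; first by move=> v; exact: finite_set0.
  split=> //; split; first by move=> [] []; exists (gone g).
  move=> v; rewrite (_ : [set x | _] = setT); last by apply/seteqP; split.
  by split=> //; exact: openT.
by move=> v; rewrite II0; exact: card_eq00.
Qed.

Lemma md_eq2_cases : md_eq g 2 ->
  onto_Z_compact_open_kernel g \/ onto_Dinf_compact_open_kernel g.
Proof.
move=> md; have nc := md_eq2_not_compact md.
case: md => -[V [adj [act [CA0 deg]]]] _.
(* [{classic V}] equips the vertices with the choice structure needed for counting. *)
have CA : @cayley_abels G g {classic V} adj act := CA0.
have [|A [fA iA iCA eA eCA]] :=
  two_regular_split (ca_sym CA) (ca_irr CA) (ca_conn CA) deg.
  by move=> fV; apply: nc; exact: (ca_finite_compact CA).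
exact: (end_like_cases CA fA).
Qed.

Lemma two_ended_cases : two_ended g ->
  onto_Z_compact_open_kernel g \/ onto_Dinf_compact_open_kernel g.
Proof.
move=> [V [adj [act [CA0 te]]]].
have CA : @cayley_abels G g {classic V} adj act := CA0.
have [A [fA iA iCA eA eCA]] :=
  @two_ended_split {classic V} adj (ca_sym CA) (ca_conn CA) (ca_locfin CA) te.
exact: (end_like_cases CA fA).
Qed.

End Cases12.

(** * Compact open subgroups and coset graphs *)

Section Separation.
Context {T : topologicalType}.

(** Take the union of a finite subcover and the intersection of the matching neighbourhoods of [Y].
    Used once to separate a point from a compact set, and again for two compact sets. *)
Lemma compact_separate (X Y : set T) : compact X ->
  (forall x, X x -> exists U V, [/\ open U, open V, U x, Y `<=` V & U `&` V = set0]) ->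
  exists U V, [/\ open U, open V, X `<=` U, Y `<=` V & U `&` V = set0].
Proof.
move=> cX sep.
pose I := {p : set T * set T | [/\ open p.1, open p.2, Y `<=` p.2 & p.1 `&` p.2 = set0]}.
have [||D fD XD] := @compact_finite_cover T I X (fun p => (sval p).1) cX.
- by move=> [p []].
- move=> x /sep [U [V [oU oV Ux YV UV]]].
  by exists (exist _ (U, V) (And4 oU oV YV UV)).
exists (\bigcup_(p in D) (sval p).1), (\bigcap_(p in D) (sval p).2); split=> //.
- by apply: bigcup_open => -[p []].
- by apply: bigcap_finite_open => // -[p []].
- by move=> y Yy -[p [/= oU oV YV UV]] _; exact: YV.
- apply/seteqP; split=> // x [[p Dp xp] /(_ p Dp) xp2].
  have [_ _ _ E] := svalP p.
  by have : ((sval p).1 `&` (sval p).2) x by []; rewrite E.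
Qed.

Lemma hausdorff_compact_separate (X Y : set T) : hausdorff_space T ->
  compact X -> compact Y -> X `&` Y = set0 ->
  exists U V, [/\ open U, open V, X `<=` U, Y `<=` V & U `&` V = set0].
Proof.
rewrite open_hausdorff => hT cX cY XY.
apply: compact_separate => // x Xx.
have [|U [V [oU oV YU xV UV]]] := @compact_separate Y [set x] cY.
  move=> y Yy; have xy : x != y.
    apply/eqP => E; suff : (X `&` Y) x by rewrite XY.
    by split=> //; rewrite E.
  have [[U V] /= [/set_mem Ux /set_mem Vy] [oU oV /eqP UV]] := hT x y xy.
  by exists V, U; split=> //; [move=> _ ->|rewrite setIC].
by exists V, U; split=> //; [exact: xV|rewrite setIC].
Qed.

Lemma totally_disconnected_closed1 (x : T) :
  totally_disconnected [set: T] -> closed [set x].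
Proof. by move=> /(_ x I) <-; apply: component_closed; exact: closedT. Qed.

(* Quasi-components of a compact Hausdorff space are connected. *)
Lemma tdlc_clopen_nbhd (x : T) (K : set T) : hausdorff_space T ->
  totally_disconnected [set: T] -> compact K -> nbhs x K ->
  exists D, [/\ open D, compact D & D x].
Proof.
move=> hT td cK nK; have clK : closed K by exact: compact_closed.
have Kx : K x by exact: nbhs_singleton.
(* The relatively clopen subsets of [K] that contain [x]. *)
pose rc D := [/\ closed D, D x & exists2 O, open O & D = K `&` O].
have rcK : rc K by split=> //; exists setT; [exact: openT|rewrite setIT].
have rcI D E : rc D -> rc E -> rc (D `&` E).
  move=> [cD Dx [O oO DO]] [cE Ex [P oP EP]]; split; [exact: closedI|by []|].
  by exists (O `&` P); [exact: openI|rewrite DO EP setIACA setIid].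
have sub D : rc D -> D `<=` K by move=> [_ _ [O _ ->]] y [].
(* By compactness finitely many such sets exclude all of [X], and their intersection is again of
   this kind. *)
have shrink X : compact X -> (forall y, X y -> exists2 D, rc D & ~ D y) ->
    exists2 D, rc D & D `&` X = set0.
  move=> cX out.
  have [||F fF XF] := @compact_finite_cover T {D | rc D} X (fun D => ~` sval D) cX.
  - by move=> D; apply: closed_openC; case: (svalP D).
  - by move=> y /out [D rD nDy]; exists (exist _ D rD).
  have [D rD DF] : exists2 D, rc D & forall E, F E -> D `<=` sval E.
    have /finite_seqP [s Fs] : @finite_set {classic {D | rc D}} F by [].
    rewrite Fs; elim: s {Fs} => [|E s [D rD DF]]; first by exists K.
    exists (sval E `&` D); first by apply: rcI => //; exact: svalP.
    move=> E'; rewrite /= in_cons => /orP [/eqP ->|/DF DE'] y [] //.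
    by move=> _ /DE'.
  exists D => //; apply/seteqP; split=> // y [Dy /XF [E FE]]; apply.
  exact: DF Dy.
pose Q := [set y | forall D, rc D -> D y].
have clQ : closed Q.
  rewrite (_ : Q = \bigcap_(D in rc) D); last by apply/seteqP; split.
  by apply: closed_bigI => D [].
have QK : Q `<=` K by move=> y; exact.
have cQ : compact Q by exact: subclosed_compact QK.
have Qx : Q x by move=> D [].
(* Enclose the two parts in disjoint open sets [U] and [V]. Some clopen [D] lies in their union, so
   its trace on [U] is clopen as well and contains [Q]. *)
have part B1 B2 : closed B1 -> closed B2 -> Q = B1 `|` B2 -> B1 `&` B2 = set0 ->
    B1 x -> B2 = set0.
  move=> c1 c2 Q12 B12 B1x.
  have cB1 : compact B1 by apply: (subclosed_compact c1 cQ); rewrite Q12; left.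
  have cB2 : compact B2 by apply: (subclosed_compact c2 cQ); rewrite Q12; right.
  have [U [V [oU oV BU BV UV]]] := hausdorff_compact_separate hT cB1 cB2 B12.
  have cX : compact (K `\` (U `|` V)).
    apply: (subclosed_compact _ cK); last by move=> y [].
    by rewrite setDE; apply: closedI => //; apply: open_closedC; exact: openU.
  have [|D rD DX] := shrink _ cX.
    move=> y [Ky nUV]; apply: contrapT => nD; apply: nUV.
    have : Q y by move=> D rD; apply: contrapT => nDy; apply: nD; exists D.
    by rewrite Q12 => -[/BU|/BV]; [left|right].
  have DUV y : D y -> U y \/ V y.
    move=> Dy; apply: contrapT => nUV.
    suff : (D `&` (K `\` (U `|` V))) y by rewrite DX.
    by split=> //; split=> //; exact: (sub D rD).
  have nUV y : U y -> V y -> False.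
    by move=> Uy Vy; suff : (U `&` V) y by rewrite UV.
  have rDU : rc (D `&` U).
    split.
    - rewrite (_ : D `&` U = D `&` ~` V).
        by apply: closedI; [case: rD|exact: open_closedC].
      apply/seteqP; split=> y [Dy].
        by move=> Uy; split=> // Vy; exact: nUV Uy Vy.
      by move=> nVy; split=> //; have [|] := DUV y Dy.
    - by split; [case: rD|exact: BU].
    - case: rD => _ _ [O oO ->]; exists (O `&` U); first exact: openI.
      by rewrite setIA.
  apply/seteqP; split=> // y B2y.
  have : Q y by rewrite Q12; right.
  by move=> /(_ _ rDU) [_ Uy]; apply: (nUV y Uy); exact: BV.
have connQ : connected Q.
  move=> B [b Bb] [O oO BO] [C cC BC].
  have clB : closed B by rewrite BC; exact: closedI.
  have clB' : closed (Q `\` B).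
    rewrite (_ : Q `\` B = Q `&` ~` O).
      by apply: closedI => //; exact: open_closedC.
    by apply/seteqP; split=> y [Qy]; rewrite BO => n; split=> // h; apply: n;
      [split|case: h].
  have BQ : B `<=` Q by rewrite BO => y [].
  have [Bx|nBx] := pselect (B x).
    have : Q `\` B = set0.
      by apply: (part B) => //; [rewrite setDUK|rewrite setDIK].
    by rewrite setD_eq0 => QB; apply/seteqP.
  have : B = set0.
    apply: (part (Q `\` B)) => //; first by rewrite setUC setDUK.
    by rewrite setIC setDIK.
  by move=> B0; rewrite B0 in Bb.
have Q1 y : Q y -> y = x.
  move=> Qy; have : connected_component setT x y by exists Q.
  by rewrite (td x I).
(* As the quasi-component is [x] alone, some clopen [D] avoids the compact set of non-interior
   points of [K]; relatively open and inside the interior, it is open. *)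
have cX : compact (K `\` K^°).
  apply: (subclosed_compact _ cK); last by move=> y [].
  by rewrite setDE; apply: closedI => //; apply: open_closedC; exact: open_interior.
have [|D rD DX] := shrink _ cX.
  move=> y [Ky nKy]; apply: contrapT => nD; apply: nKy.
  suff -> : y = x by [].
  by apply: Q1 => D rD; apply: contrapT => nDy; apply: nD; exists D.
have DK := sub D rD; case: rD => cD Dx [O oO DO]; exists D; split=> //.
  rewrite (_ : D = K^° `&` O); first by apply: openI => //; exact: open_interior.
  apply/seteqP; split=> [y Dy|y [Ky Oy]]; last first.
    by rewrite DO; split=> //; exact: interior_subset.
  split; last by move: Dy; rewrite DO => -[].
  apply: contrapT => nKy; suff : (D `&` (K `\` K^°)) y by rewrite DX.
  by split=> //; split=> //; exact: DK.
exact: subclosed_compact DK.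
Qed.

End Separation.

Section VanDantzig.
Context {G : topologicalType} (g : tgroup G).
Local Notation "x * y" := (gmul g x y).
Local Notation "1" := (gone g).
Local Notation "x ^-1" := (ginv g x).

Lemma gdiv_cont : continuous (fun p : G * G => p.1^-1 * p.2).
Proof.
move=> [x y].
apply: (@continuous_comp _ _ _ (fun p : G * G => (p.1^-1, p.2)) (fun p => p.1 * p.2)).
  apply: cvg_pair; last exact: cvg_snd.
  by apply: (@continuous_comp _ _ _ fst (ginv g)); [exact: cvg_fst|exact: ginv_cont].
exact: gmul_cont.
Qed.

(** Singletons are closed, so for distinct [p] and [q] the quotient stays away from 1 on a product
    of neighbourhoods; a common point would give quotient 1. *)
Lemma td_hausdorff : totally_disconnected [set: G] -> hausdorff_space G.
Proof.
move=> td p q clpq; apply: contrapT => pq.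
have o1 : open (~` [set 1]) by apply: closed_openC; exact: totally_disconnected_closed1.
have : nbhs (p^-1 * q) (~` [set 1]).
  apply: open_nbhs_nbhs; split=> // E; apply: pq.
  by rewrite -(gmulVKl g p q) E gmul1r.
move=> /(@gdiv_cont (p, q)) [[A B] /= [nA nB] AB].
have [z [Az Bz]] := clpq A B nA nB.
by apply: (AB (z, z)) => //=; rewrite gmulVl.
Qed.

Lemma open_subgroup_closed (U : set G) : is_subgroup g U -> open U -> closed U.
Proof.
move=> [U1 [UM UV]] oU; rewrite -[X in closed X]setCK; apply: open_closedC.
rewrite openE => x nUx; rewrite /interior nbhsE /=.
exists [set y | U (x^-1 * y)]; first by split; [exact: open_gmull|rewrite /= gmulVl].
move=> y Uxy Uy; apply: nUx; rewrite -(ginvK g x); apply: (UV _ _).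
by rewrite -(gmulKr g y (x^-1)); apply: UM => //; exact: UV.
Qed.

Theorem van_dantzig : @tdlc G ->
  exists U : set G, [/\ is_subgroup g U, open U & compact U].
Proof.
move=> [td lc]; have hG := td_hausdorff td; have [K [nK cK]] := lc 1.
have [D [oD cD D1]] := tdlc_clopen_nbhd hG td cK nK.
(* Right translations mapping [D] into itself. Compactness of [D] makes [W] a neighbourhood of 1,
   and [W] with its inverses gives a subgroup, contained in [D] because 1 is in [D]. *)
pose W := [set x | forall d, D d -> D (d * x)].
have nW : nbhs 1 W.
  apply: ((compact_near_coveringP D).1 cD G (nbhs 1) (fun x d => D (d * x)) _).
  move=> d Dd.
  have : nbhs (d * 1) D by rewrite gmul1r; exact: open_nbhs_nbhs.
  by move=> /(@gmul_cont _ g (d, 1)).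
have nWV : nbhs 1 [set x | W x^-1].
  by have := @ginv_cont _ g 1 W; rewrite ginv1; exact.
pose U := W `&` [set x | W x^-1].
have sU : is_subgroup g U.
  split; first by split=> d Dd; rewrite ?ginv1 gmul1r.
  split; last by move=> x [Wx WVx]; split=> //=; rewrite ginvK.
  move=> x y [Wx WVx] [Wy WVy]; split=> d Dd; first by rewrite gmulA; apply/Wy/Wx.
  by rewrite ginvM gmulA; apply/WVx/WVy.
have oU : open U.
  rewrite openE => x Ux; have nU : nbhs 1 U by exact: filterI.
  have nU' : nbhs (x^-1 * x) U by rewrite gmulVl.
  have nxU : nbhs x [set y | U (x^-1 * y)] := @gmull_cont _ g x^-1 x U nU'.
  apply: filterS nxU => y Uxy.
  by rewrite -(gmulVKl g x y); case: sU => _ [+ _]; exact.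
exists U; split=> //; apply: (subclosed_compact _ cD).
  exact: open_subgroup_closed.
by move=> x [Wx _]; rewrite -(gmul1l g x); exact: Wx.
Qed.

Lemma compact_gmulr a (K : set G) : compact K -> compact [set x | K (x * a)].
Proof.
move=> cK; rewrite (_ : [set x | _] = (fun x => x * a^-1) @` K).
  by apply: compact_image_cont => //; exact: gmulr_cont.
apply/seteqP; split=> [x Kx|_ [y Ky <-]] /=; last by rewrite -gmulA gmulVl gmul1r.
by exists (x * a) => //; rewrite gmulKr.
Qed.

Lemma compact_ginv (K : set G) : compact K -> compact [set x | K x^-1].
Proof.
move=> cK; rewrite (_ : [set x | _] = ginv g @` K).
  by apply: compact_image_cont => //; exact: ginv_cont.
apply/seteqP; split=> [x Kx|_ [y Ky <-]] /=; last by rewrite ginvK.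
by exists x^-1 => //; rewrite ginvK.
Qed.

(** * The coset graph of a compact open subgroup *)

Section CosetGraph.
Context (U K : set G).
Hypotheses (sU : is_subgroup g U) (oU : open U) (cU : compact U) (cK : compact K)
  (genK : generates g K).

Let U1 : U 1. Proof. by case: sU. Qed.
Let UM x y : U x -> U y -> U (x * y). Proof. by case: sU => _ [+ _]; exact. Qed.
Let UV x : U x -> U x^-1. Proof. by case: sU => _ [_ +]; exact. Qed.

Definition coset_set x : set G := [set y | U (x^-1 * y)].
Definition coset_space := {A : set G | exists x, A = coset_set x}.
Definition coset x : coset_space := exist _ (coset_set x) (ex_intro _ x erefl).

Lemma coset_eq x y : coset x = coset y <-> U (x^-1 * y).
Proof.
split=> [/(congr1 sval) /= E|Uxy].
  by have : coset_set y y by [rewrite /coset_set /= gmulVl]; rewrite -E.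
apply: eq_exist => /=; apply/seteqP; split=> z; rewrite /coset_set /= => Uz.
  rewrite -(gmulVKl g x z) gmulA; apply: UM => //.
  by have := UV Uxy; rewrite ginvM ginvK.
by rewrite -(gmulVKl g y z) gmulA; apply: UM.
Qed.

Lemma cosetP v : exists x, v = coset x.
Proof. by case: v => A [x Ax]; exists x; exact: eq_exist. Qed.

Definition coset_act x (v : coset_space) : coset_space :=
  coset (x * projT1 (cid (cosetP v))).

Lemma coset_actE x y : coset_act x (coset y) = coset (x * y).
Proof.
rewrite /coset_act; case: cid => z /= /coset_eq Uyz; apply/esym/coset_eq.
by rewrite ginvM -gmulA gmulKl.
Qed.

(** The double cosets [U k U] for [k] in [K] or its inverse, so that adjacency is symmetric and
    independent of representatives. *)
Definition coset_step x := exists u k u',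
  [/\ U u, K k \/ K k^-1, U u' & x = u * (k * u')].

Definition coset_adj (v w : coset_space) :=
  v <> w /\ exists x y, [/\ v = coset x, w = coset y & coset_step (x^-1 * y)].

Lemma coset_stepV x : coset_step x -> coset_step x^-1.
Proof.
move=> [u [k [u' [Uu Kk Uu' ->]]]]; exists (u'^-1), (k^-1), (u^-1); split.
- exact: UV.
- by rewrite ginvK; tauto.
- exact: UV.
- by rewrite !ginvM gmulA.
Qed.

Lemma coset_adj_sym v w : coset_adj v w -> coset_adj w v.
Proof.
move=> [vw [x [y [vx wy s]]]]; split; first exact/nesym.
by exists y, x; split=> //; have := coset_stepV s; rewrite ginvM ginvK.
Qed.

Lemma coset_adj_act x v w : coset_adj v w -> coset_adj (coset_act x v) (coset_act x w).
Proof.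
move=> [vw [y [z [vy wz s]]]]; subst v w; rewrite !coset_actE; split.
  by move=> /coset_eq; rewrite ginvM -gmulA gmulKl => /coset_eq.
by exists (x * y), (x * z); split=> //; rewrite ginvM -gmulA gmulKl.
Qed.

Lemma compact_finite_cosets (X : set G) : compact X ->
  exists2 D : set G, finite_set D & X `<=` \bigcup_(z in D) coset_set z.
Proof.
move=> cX; apply: compact_finite_cover => // [z|x _].
  exact: open_gmull.
by exists x => //; rewrite /coset_set /= gmulVl.
Qed.

(** Finitely many cosets [z U] cover [K] and its inverses, and each compact set [U z] is covered by
    finitely many cosets [y U]. *)
Lemma coset_step_finite : exists2 D : set G, finite_set D &
  coset_step `<=` \bigcup_(z in D) coset_set z.
Proof.
have cK' : compact (K `|` [set k | K k^-1]).
  by apply: compactU => //; exact: compact_ginv.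
have [D fD KD] := compact_finite_cosets cK'.
have fin z : exists D' : set G, finite_set D' /\
    [set x | U (x * z^-1)] `<=` \bigcup_(y in D') coset_set y.
  have [D' fD' H] := compact_finite_cosets (compact_gmulr (a := z^-1) cU).
  by exists D'.
have [E HE] := choice fin.
exists (\bigcup_(z in D) E z).
  by apply: bigcup_finite => // z _; case: (HE z).
move=> _ [u [k [u' [Uu Kk Uu' ->]]]].
have [z Dz Uzk] : (\bigcup_(z in D) coset_set z) k by apply: KD.
have [_ /(_ (u * z)) []] := HE z; first by rewrite /= gmulKr.
move=> y Ezy Uy; exists y; first by exists z.
rewrite /coset_set /= (_ : _ * _ = (y^-1 * (u * z)) * ((z^-1 * k) * u')).
  by apply: UM => //; apply: UM.
by rewrite -!gmulA gmulVKl.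
Qed.

Lemma coset_nbrs_finite v : finite_set [set w | coset_adj v w].
Proof.
have [x ->] := cosetP v; have [D fD SD] := coset_step_finite.
apply: sub_finite_set (finite_image (fun z => coset (x * z)) fD).
move=> w [_ [x' [y [/coset_eq Uxx' -> [u [k [u' [Uu Kk Uu' E]]]]]]]].
have [z Dz Uz] : (\bigcup_(z in D) coset_set z) (x^-1 * y).
  apply: SD; exists ((x^-1 * x') * u), k, u'; split=> //; first exact: UM.
  by rewrite -gmulA -E -gmulA gmulVKl.
exists z => //; apply/coset_eq.
by rewrite ginvM -gmulA; exact: Uz.
Qed.

(** The elements [x] for which [coset x] is connected to [coset 1] form a subgroup containing
    [K]. *)
Lemma coset_conn v w : clos_refl_trans coset_space coset_adj v w.
Proof.
set R := clos_refl_trans _ _.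
have Ract x a b : R a b -> R (coset_act x a) (coset_act x b).
  elim=> [c d cd|c|c d e _ cd _ de]; last exact: rt_trans cd de.
    by apply: rt_step; exact: coset_adj_act.
  exact: rt_refl.
have Rsym a b : R a b -> R b a.
  elim=> [c d cd|c|c d e _ dc _ ed]; last exact: rt_trans ed dc.
    by apply: rt_step; exact: coset_adj_sym.
  exact: rt_refl.
have HT : [set x | R (coset 1) (coset x)] = setT.
  apply: genK.
    split; first exact: rt_refl.
    split=> [x y Rx Ry|x Rx] /=.
      apply: (@rt_trans _ _ _ (coset x)) => //.
      by have := Ract x _ _ Ry; rewrite !coset_actE gmul1r.
    by have := Ract x^-1 _ _ (Rsym _ _ Rx); rewrite !coset_actE gmulVl gmul1r.
  move=> k Kk /=; have [->|neq] := pselect (coset 1 = coset k); first exact: rt_refl.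
  apply: rt_step; split=> //; exists 1, k; split=> //; exists 1, k, 1; split=> //.
    by left.
  by rewrite ginv1 gmul1r.
have [x ->] := cosetP v; have [y ->] := cosetP w.
have Rxy : R (coset 1) (coset (x^-1 * y)).
  by have : [set x | R (coset 1) (coset x)] (x^-1 * y) by rewrite HT.
by have := Ract x _ _ Rxy; rewrite !coset_actE gmul1r gmulVKl.
Qed.

Lemma coset_cayley_abels : cayley_abels g coset_adj coset_act.
Proof.
split; first exact: (inhabits (coset 1)).
split; first by split; [exact: coset_adj_sym|move=> v [/(_ erefl)]].
split; first exact: coset_conn.
split; first exact: coset_nbrs_finite.
have act1 v : coset_act 1 v = v.
  by have [x ->] := cosetP v; rewrite coset_actE gmul1l.
have actM x y v : coset_act (x * y) v = coset_act x (coset_act y v).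
  by have [z ->] := cosetP v; rewrite !coset_actE gmulA.
split.
  split=> //; split=> // x v w; split; first exact: coset_adj_act.
  by move=> /(coset_adj_act x^-1); rewrite -!actM gmulVl !act1.
split.
  move=> v w; have [x ->] := cosetP v; have [y ->] := cosetP w.
  by exists (y * x^-1); rewrite coset_actE -gmulA gmulVl gmul1r.
move=> v; have [y ->] := cosetP v.
rewrite (_ : [set x | _] = [set x | [set z | U (y^-1 * z)] (x * y)]).
  by split; [apply: open_gmulr; exact: open_gmull
            |apply: compact_gmulr; exact: compact_gmull].
apply/seteqP; split=> x /=; rewrite coset_actE.
  by move=> /esym /coset_eq.
by move=> Ux; apply/esym/coset_eq.
Qed.

End CosetGraph.
End VanDantzig.

(** * Cocompact discrete cyclic subgroups *)

Section Cocompact.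
Context {G : topologicalType} (g : tgroup G).
Local Notation "x * y" := (gmul g x y).
Local Notation "1" := (gone g).
Local Notation "x ^-1" := (ginv g x).
Context (c : G).
Local Notation C := (cyclic_sub g c).
Hypotheses (infC : infinite_set C) (discC : discrete_sub C)
  (cocC : compact_quotient g C).

(** If a positive power of [c] were trivial, reducing exponents modulo it would make the cyclic
    group finite. *)
Lemma gpow_inj : injective (gpow g c).
Proof.
suff tf (d : nat) : (0 < d)%N -> gpow g c d <> 1.
  have H m n : (m < n)%R -> gpow g c m <> gpow g c n.
    move=> mn E; apply: (tf `|(n - m)%R|%N); first by lia.
    have -> : Posz `|(n - m)%R|%N = (- m + n)%R by lia.
    by rewrite gpowD gpowN E gmulVl.
  by move=> m n E; have [/H|/H|//] := ltgtP m n; rewrite E.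
move=> d0 cd; apply: infC.
apply: (@sub_finite_set _ _ ((fun k : nat => gpow g c k) @` `I_d)); last first.
  exact: finite_image.
move=> _ [n ->].
have cq q : gpow g c (q * Posz d)%R = 1.
  have pos (k : nat) : gpow g c (Posz k * Posz d)%R = 1.
    elim: k => [|k IH]; first by rewrite mul0r.
    by rewrite -addn1 PoszD mulrDl mul1r gpowD IH cd gmul1l.
  case: q => q //; by rewrite NegzE mulNr gpowN pos ginv1.
have d0z : Posz d != 0%R by lia.
have := modz_ge0 n d0z; have := ltz_mod n d0z => r1 r0.
exists `|(n %% Posz d)%Z|%N => /=; first by lia.
rewrite -[LHS]/(gpow g c (Posz _)) gez0_abs // [in RHS](divz_eq n (Posz d)).
by rewrite [in RHS]gpowD cq gmul1l.
Qed.

(** Every point has a neighbourhood containing at most one element of [C]: quotients of its elements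
    lie in an open set that meets [C] only in 1. *)
Lemma discrete_compact_finite (X : set G) : compact X -> finite_set (X `&` C).
Proof.
move=> cX; have [|V0 [oV V0C]] := @discC 1; first by exists 0%R.
pose I := {N : set G | open N /\ forall x y, (N `&` C) x -> (N `&` C) y -> x = y}.
have [||D fD XD] := @compact_finite_cover G I X sval cX.
- by move=> N; case: (svalP N).
- move=> z Xz.
  have : nbhs (z^-1 * z) V0.
    rewrite gmulVl; apply: open_nbhs_nbhs; split=> //.
    by have : [set 1] 1 by []; rewrite -V0C => -[].
  move=> /(@gdiv_cont _ g (z, z)) [[A B] /= [nA nB] AB].
  have : nbhs z (A `&` B) by exact: filterI.
  rewrite nbhsE => -[N [oN Nz] NAB].
  have sN x y : (N `&` C) x -> (N `&` C) y -> x = y.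
    move=> [Nx [m xm]] [Ny [n yn]].
    have : (V0 `&` C) (x^-1 * y).
      split; first by apply: (AB (x, y)); split; [case: (NAB x Nx)|case: (NAB y Ny)].
      by exists (- m + n)%R; rewrite gpowD gpowN xm yn.
    by rewrite V0C /= => E; rewrite -(gmulVKl g x y) E gmul1r.
  by exists (exist _ N (conj oN sN)).
apply: (@sub_finite_set _ _ (\bigcup_(N in D) (sval N `&` C))).
  by move=> x [/XD [N DN Nx] Cx]; exists N.
apply: bigcup_finite => // N _; have [_ sN] := svalP N.
have [[x Nx]|nx] := pselect (exists x, (sval N `&` C) x).
  by apply: (@sub_finite_set _ _ [set x]) => // y Ny; exact: sN.
by apply: (@sub_finite_set _ _ set0) => // x Nx; apply: nx; exists x.
Qed.

Context {V : choiceType} (adj : V -> V -> Prop) (act : G -> V -> V).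
Hypothesis CA : cayley_abels g adj act.
Let a n v := act (gpow g c n) v.

Let aD m n v : a (m + n)%R v = a m (a n v).
Proof. by rewrite /a gpowD (ca_actM CA). Qed.

Let a0 v : a 0%R v = v. Proof. exact: (ca_act1 CA). Qed.

(** The elements carrying a point of [S] into [T] form a compact set, which meets the discrete group
    in finitely many powers. *)
Lemma orbit_bound (S T : set V) : finite_set S -> finite_set T ->
  exists N : nat, forall n s t, S s -> T t -> a n s = t -> (`|n| < N)%N.
Proof.
move=> fS fT.
pose X := \bigcup_(p in S `*` T) [set x | act x p.1 = p.2].
have cX : compact X.
  by apply: bigcup_finite_compact; [exact: finite_setX|move=> p; exact: (ca_compact CA)].
have fI : finite_set (gpow g c @^-1` (X `&` C)).
  apply: finite_preimage; first by move=> m n _ _; exact: gpow_inj.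
  exact: discrete_compact_finite.
have [N HN] := finite_nat_bounded (finite_image absz fI).
exists N => n s t Ss Tt E; apply: HN; exists n => //.
by split; [exists (s, t)|exists n].
Qed.

(** For each vertex [w] consider the [x] that send, by their inverse, [v0] into the orbit of [w].
    The inverse makes these open sets invariant under [C] on the right, so cocompactness selects
    finitely many. *)
Lemma finite_orbit_reps : exists2 F : set V, finite_set F &
  forall v, exists w n, F w /\ v = a n w.
Proof.
have [[v0] _] := CA.
have [||F [fF cov]] := @cocC V (fun w => [set x | exists n, act x^-1 v0 = a n w]).
- move=> w; split; last first.
    move=> x _ [n xn] [m ->]; exists (- m + n)%R.
    by rewrite ginvM (ca_actM CA) xn aD /a gpowN.
  rewrite openE => x [n xn]; rewrite /interior nbhsE /=.
  exists [set y | act y^-1 v0 = a n w]; last by move=> y yn; exists n.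
  by split=> //; apply: (@open_ginv _ g [set y | act y v0 = a n w]); exact: (ca_open CA).
- by apply/seteqP; split=> // x _; exists (act x^-1 v0) => //; exists 0%R; rewrite a0.
exists F => // v; have [x xv] := ca_trans CA v0 v.
have [w Fw [n E]] : (\bigcup_(w in F) [set x | exists n, act x^-1 v0 = a n w]) x^-1.
  by rewrite -cov.
by exists w, n; split=> //; rewrite -xv -E ginvK.
Qed.

Lemma a_fibers (s : bool) v w :
  finite_set [set n : nat | a (if s then - Posz n else Posz n)%R v = w].
Proof.
have [N HN] := orbit_bound (finite_set1 v) (finite_set1 w).
apply: (@sub_finite_set _ _ `I_N) => // n /= E.
by have := HN _ v w erefl erefl E; case: s {E}; lia.
Qed.

Section Reps.
Context (F : set V) (w0 : V).
Hypotheses (fF : finite_set F) (Fw0 : F w0)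
  (repF : forall v, exists w n, F w /\ v = a n w).

Let e (s : bool) (n : nat) : int := (if s then - Posz n else Posz n)%R.

(** A finite connected [H] contains [F], [w0] and the next translate of [w0]. Far translates of [H]
    miss the boundary of [B], so each lies on one side of it; consecutive ones overlap, so all lie
    on the same side. *)
Lemma tail_end_like s (X : set V) :
  (forall v, X v -> exists w n, F w /\ v = a (e s n) w) -> end_like adj X.
Proof.
move=> XF B fB.
have [|H cH HF] := finite_connected_hull (ca_conn CA) w0
    (S := F `|` [set a (e s 1) w0]).
  by rewrite finite_setU; split=> //; exact: finite_set1.
have fH : finite_set H by case: cH.
have [N HN] := orbit_bound fH fB.
have const n h : (N <= n)%N -> H h -> (B (a (e s n) h) <-> B (a (e s n) w0)).
  move=> Nn Hh; pose B' := translate g act (gpow g c (e s n))^-1 B.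
  have B'E v : B' v = B (a (e s n) v) by rewrite /B' /translate /= ginvK.
  rewrite -!B'E; apply: iff_sym.
  apply: (@conn_const _ adj B' H); first by case: cH => _ _; exact.
  apply/seteqP; split=> // v [Hv]; rewrite (bd_translate CA) /translate /= ginvK => bv.
  by have := HN (e s n) v _ Hv bv erefl; rewrite /e; case: (s); lia.
have stepB n : (N <= n)%N -> (B (a (e s n.+1) w0) <-> B (a (e s n) w0)).
  move=> Nn; rewrite -(const n (a (e s 1) w0) Nn); last by apply: HF; right.
  suff -> : e s n.+1 = (e s n + e s 1)%R by rewrite aD.
  by rewrite /e; case: (s); lia.
have allB n w : (N <= n)%N -> F w -> (B (a (e s n) w) <-> B (a (e s N) w0)).
  move=> Nn Fw; rewrite const //; last by apply: HF; left.
  rewrite -(subnKC Nn); elim: (n - N)%N => [|k IH]; first by rewrite addn0.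
  by rewrite addnS stepB //; lia.
have fin : finite_set (\bigcup_(n in `I_N) (a (e s n) @` F)).
  by apply: bigcup_finite => // n _; exact: finite_image.
have [BN|nBN] := pselect (B (a (e s N) w0)); [right|left];
  apply: sub_finite_set fin => v [/XF [w [n [Fw ->]]] Bv];
  exists n; [|by exists w| |by exists w]; rewrite /= ltnNge; apply/negP => Nn.
  by apply: Bv; apply/allB.
by apply: nBN; apply/(allB n w).
Qed.

Definition half : set V := [set v | exists w (n : nat), F w /\ v = a n w].

Lemma halfC v : ~ half v -> exists w (n : nat), F w /\ v = a (- Posz n)%R w.
Proof.
move=> nv; have [w [n [Fw vE]]] := repF v; exists w, `|n|%N; split=> //.
have [n0|n0] := leP 0%R n; last by rewrite vE; congr a; lia.
by case: nv; exists w, `|n|%N; split=> //; rewrite vE; congr a; lia.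
Qed.

Lemma half_bd_finite : finite_set (bd adj half).
Proof.
have fT : finite_set (\bigcup_(w in F) [set v | adj w v]).
  by apply: bigcup_finite => // w _; exact: (ca_locfin CA).
have [N HN] := orbit_bound fF fT.
have fin s : finite_set (\bigcup_(n in `I_N) (a (e s n) @` F)).
  by apply: bigcup_finite => // n _; exact: finite_image.
apply: (@sub_finite_set _ _ ((\bigcup_(n in `I_N) (a (e false n) @` F)) `|`
  (\bigcup_(n in `I_N) (a (e true n) @` F)))); last by rewrite finite_setU.
(* Moving a crossing edge by the power [k] gives an edge at [w'] in [F], whose other endpoint is a
   translate of [w] by the power [k + n]; hence the bound on [n + k]. *)
have key v v' : adj v v' -> half v -> ~ half v' ->
    exists w w' (n k : nat), [/\ F w, F w', v = a n w, v' = a (- Posz k)%R w' &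
      (n + k < N)%N].
  move=> vv' [w [n [Fw vE]]] /halfC [w' [k [Fw' v'E]]].
  exists w, w', n, k; split=> //.
  have := HN (Posz k + Posz n)%R w (a (Posz k + Posz n)%R w) Fw _ erefl.
  move=> /(_ _)/wrap [|]; last by lia.
  exists w' => //=; apply: (ca_sym CA); apply/(ca_adj CA (gpow g c (- Posz k)%R)).
  rewrite -[X in adj X _]/(a (- Posz k)%R _) -[X in adj _ X]/(a (- Posz k)%R _).
  by rewrite -aD addKr -vE -v'E.
move=> v [v' vv' H]; have [hv|nhv] := pselect (half v).
  have nhv' : ~ half v' by move=> hv'; apply: H.
  have [w [w' [n [k [Fw Fw' vE v'E nk]]]]] := key _ _ vv' hv nhv'.
  by left; exists n; [rewrite /=; lia|exists w].
have hv' : half v' by apply: contrapT => nhv'; apply: H; split.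
have [w [w' [n [k [Fw Fw' v'E vE nk]]]]] := key _ _ (ca_sym CA vv') hv' nhv.
by right; exists k; [rewrite /=; lia|exists w'].
Qed.

Lemma half_infinite : infinite_set half.
Proof.
move=> fh; have [N HN] := finite_fibers_eventually (a_fibers false w0) fh.
by apply: (HN N (leqnn N)); exists w0, N.
Qed.

Lemma halfC_infinite : infinite_set (~` half).
Proof.
move=> fh; have [N HN] := finite_fibers_eventually (a_fibers true w0) fh.
have [M HM] := orbit_bound fF fF.
(* If this translate of [w0] lay in [half], a power of at least [N + M] would carry a point of [F]
   to [w0], against the bound [M]. *)
apply: (HN (N + M)%N (leq_addr _ _)) => -[w [n [Fw E]]].
have := HM (Posz (N + M)%N + Posz n)%R w w0 Fw Fw0.
by rewrite aD -E -aD subrr a0 => /(_ erefl); lia.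
Qed.

End Reps.

Lemma cocompact_end_cases :
  onto_Z_compact_open_kernel g \/ onto_Dinf_compact_open_kernel g.
Proof.
have [F fF repF] := finite_orbit_reps.
have [[v0] _] := CA; have [w0 [_ [Fw0 _]]] := repF v0.
apply: (end_like_cases CA (A := half F)).
- exact: half_bd_finite.
- exact: (half_infinite Fw0).
- exact: (halfC_infinite fF Fw0).
- by apply: (@tail_end_like F w0 fF false).
- by apply: (@tail_end_like F w0 fF true) => v /(halfC repF).
Qed.

End Cocompact.

Lemma cocompact_cases (G : topologicalType) (g : tgroup G) :
  @tdlc G -> compactly_generated g -> has_cocompact_discrete_Z g ->
  onto_Z_compact_open_kernel g \/ onto_Dinf_compact_open_kernel g.
Proof.
move=> td [K [cK gK]] [c [iC dC qC]].
have [U [sU oU cU]] := van_dantzig g td.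
have CA := coset_cayley_abels sU oU cU cK gK.
exact: (@cocompact_end_cases G g c iC dC qC {classic coset_space g U} _ _ CA).
Qed.

Theorem theorem3p1 (G : topologicalType) (g : tgroup G) :
  @tdlc G -> compactly_generated g ->
  [<-> md_eq g 2;
       two_ended g;
       onto_Z_compact_open_kernel g \/ onto_Dinf_compact_open_kernel g;
       has_cocompact_discrete_Z g].
Proof.
(* The implications are proved in a cycle, each of them by way of the homomorphism in the third
   condition. *)
move=> td cg; tfae.
- move=> /md_eq2_cases /cases_Dinf_hom [phi [phiM oF cK surj]].
  exact: Dinf_hom_two_ended surj.
- exact: two_ended_cases.
- move=> /cases_Dinf_hom [phi [phiM oF cK surj]].
  exact: Dinf_hom_cocompact surj.
- move=> /(cocompact_cases td cg) /cases_Dinf_hom [phi [phiM oF cK surj]].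
  exact: Dinf_hom_md_eq2 surj.
Qed.
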